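(* Consider two control-affine systems $\Sigma_i$: $\dot x_i=f_i(x_i)+G_iu_i$, $y_i=h_i(x_i)+J_iu_i$, $i\in\{1,2\}$, with $u_1,y_2\in\mathbb{R}^m$ and $y_1,u_2\in\mathbb{R}^p$, under the negative feedback interconnection $u_1=v_1-y_2$, $u_2=v_2+y_1$, with $I_p+J_1J_2$ nonsingular (see context). Suppose that: - for $i\in\{1,2\}$, $\Sigma_i$ satisfies the EID Hill-Moylan conditions (see context) with convex function $V_i$ and supply parameters $(Q_i,S_i,R_i)$; - for every constant $(\bar v_1,\bar v_2)$, the inclusions $\bar y_1\in\mathcal{K}_{\Sigma_1}(\bar v_1-\bar y_2)$, $\bar y_2\in\mathcal{K}_{\Sigma_2}(\bar v_2+\bar y_1)$ possess a unique solution $(\bar y_1,\bar y_2)$, with $(\bar x_1,\bar x_2)\in\mathcal{E}_{\Sigma_{\rm cl}}:=\mathcal{E}_{\Sigma_1}\times\mathcal{E}_{\Sigma_2}$ being a corresponding closed-loop equilibrium point. Then for any $\kappa>0$, the closed-loop system with inputs $(v_1,v_2)$ and outputs $(y_1,y_2)$ is EID with the quadratic supply rate with parameters $$Q_{\rm cl}=\begin{bmatrix}Q_1+\kappa R_2&-S_1+\kappa S_2^{\mathsf T}\\-S_1^{\mathsf T}+\kappa S_2&R_1+\kappa Q_2\end{bmatrix},\quad S_{\rm cl}=\begin{bmatrix}S_1&R_2\\R_1&S_2\end{bmatrix},\quad R_{\rm cl}=\begin{bmatrix}R_1&0\\0&R_2\end{bmatrix}$$ and storage function $V_{\bar x}(x)=V_{1,\bar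 x_1}(x_1)+\kappa V_{2,\bar x_2}(x_2)$, where $V_{i,\bar x_i}(x_i)=V_i(x_i)-V_i(\bar x_i)-\nabla V_i(\bar x_i)^{\mathsf T}(x_i-\bar x_i)$. Moreover, if $V_1$ and $V_2$ are strictly convex, $\Sigma_1$ and $\Sigma_2$ are equilibrium-independent observable, and there exists $\kappa>0$ such that $Q_{\rm cl}\prec0$, then $\bar x=(\bar x_1,\bar x_2)\in\mathcal{E}_{\Sigma_{\rm cl}}$ with associated constant inputs $(\bar v_1,\bar v_2)=k_u(\bar x)$ is the unique closed-loop equilibrium point for the constant inputs $(v_1,v_2)=(\bar v_1,\bar v_2)$ and is locally asymptotically stable. If $V_1$ and $V_2$ are strongly convex, then the previous statement is strengthened to global asymptotic stability of $\bar x$.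
   Context: Each system $\Sigma$ (dropping the index) has the form $\dot x=f(x)+Gu$, $y=h(x)+Ju$ with state space $\mathcal{X}$ a Euclidean space $\mathbb{R}^{n}$, input space $\mathcal{U}$ and output space $\mathcal{Y}$ Euclidean of dimension at most $n$; $f$ and $h$ are sufficiently smooth that trajectories are forward complete for all initial conditions and all $\mathscr{L}_{2e}[0,\infty)$ inputs, with outputs in $\mathscr{L}_{2e}[0,\infty)$; $G$ is constant with full column rank; $J$ is constant. Equilibria: $\mathcal{E}_\Sigma=\{\bar x\in\mathcal{X}:\exists\,\bar u,\ f(\bar x)+G\bar u=0\}$. For $\bar x\in\mathcal{E}_\Sigma$ the unique equilibrium input and output are $\bar u=k_u(\bar x)=-(G^{\mathsf T}G)^{-1}G^{\mathsf T}f(\bar x)$, $\bar y=k_y(\bar x)=h(\bar x)+Jk_u(\bar x)$. The equilibrium I/O relation is $\mathcal{K}_\Sigma=\{(\bar u,\bar y):\exists\,\bar x\in\mathcal{E}_\Sigma,\ \bar u=k_u(\bar x),\ \bar y=k_y(\bar x)\}$; $\mathcal{K}_\Sigma(\bar u)=\{\bar y:(\bar u,\bar y)\in\mathcal{K}_\Sigma\}$. Quadratic supply rate with parameters $(Q,S,R)$, $Q=Q^{\mathsf T}$, $R=R^{\mathsf T}$: $\mathsf{w}(u,y)=y^{\mathsf T}Qy+2y^{\mathsf T}Su+u^{\mathsf T}Ru$. For the given $(Q_i,S_i,R_i)$ the matrix $\begin{bmatrix}Q_i&S_i\\S_i^{\mathsf T}&R_i\end{bmatrix}$ is sign-indefinite.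 For the closed loop, the input is $v=(v_1,v_2)$ and the output is $y=(y_1,y_2)$. EID (equilibrium-independent dissipative) with supply rate $\mathsf{w}$ and storage functions $\{V_{\bar x}\}_{\bar x\in\mathcal{E}_\Sigma}$: for every $\bar x\in\mathcal{E}_\Sigma$, with $\bar u=k_u(\bar x)$, $\bar y=k_y(\bar x)$, $V_{\bar x}:\mathcal{X}\to\mathbb{R}_{\ge0}$ is continuously differentiable, $V_{\bar x}(\bar x)=0$, and $\nabla V_{\bar x}(x)^{\mathsf T}(f(x)+Gu)\le\mathsf{w}(u-\bar u,y-\bar y)$ along all trajectories, at all $t\ge0$, for all measurable $\mathscr{L}_{2e}$ inputs. Because $I_p+J_1J_2$ is nonsingular, the interconnection is well-posed: eliminating $u_1,u_2$ gives a closed-loop system $\Sigma_{\rm cl}$ of the same control-affine form with state $x=(x_1,x_2)$, input $v$, output $y$, and $k_u$ in the claim is its equilibrium-to-input map, i.e. $\bar v_1=k_{u,1}(\bar x_1)+\bar y_2$, $\bar v_2=k_{u,2}(\bar x_2)-\bar y_1$ with $\bar y_i=k_{y,i}(\bar x_i)$, where $k_{u,i},k_{y,i}$ are the maps $k_u,k_y$ of $\Sigma_i$. EID Hill-Moylan conditions for $\Sigma$ with $V$ and $(Q,S,R)$: $V:\mathcal{X}\to\mathbb{R}_{\ge0}$ is continuously differentiable and convex, and there exist an integer $k>0$, a matrix $W$ with $k$ rows and $\dim\mathcal{U}$ columns, and $\ell:\mathcal{X}\times\mathcal{X}\to\mathbb{R}^k$ such that for all $(x,\bar x)\in\mathcal{X}\times\mathcal{E}_\Sigma$: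 $[\nabla V(x)-\nabla V(\bar x)]^{\mathsf T}[f(x)-f(\bar x)]=[h(x)-h(\bar x)]^{\mathsf T}Q[h(x)-h(\bar x)]-\|\ell(x,\bar x)\|_2^2$; $\frac12[\nabla V(x)-\nabla V(\bar x)]^{\mathsf T}G=[h(x)-h(\bar x)]^{\mathsf T}(QJ+S)-\ell(x,\bar x)^{\mathsf T}W$; $W^{\mathsf T}W=R+J^{\mathsf T}S+S^{\mathsf T}J+J^{\mathsf T}QJ$. Equilibrium-independent observable: for every $\bar x\in\mathcal{E}_\Sigma$ with $\bar u=k_u(\bar x)$, $\bar y=k_y(\bar x)$, no trajectory of $\dot x=f(x)+G\bar u$ can remain within $\{x:h(x)+J\bar u=\bar y\}$ other than $x(t)=\bar x$. Strictly convex: $[\nabla V(x)-\nabla V(z)]^{\mathsf T}(x-z)>0$ for $x\ne z$; strongly convex: $[\nabla V(x)-\nabla V(z)]^{\mathsf T}(x-z)\ge\mu\|x-z\|_2^2$ for some $\mu>0$ and all $x,z$.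
   Formalization: The claim fails with the displayed S_cl and R_cl; the theorem is proved with S_cl = [S_1, κR_2; -R_1, κS_2] and R_cl = diag(R_1, κR_2), the coefficients of w_1(v_1-y_2,y_1)+κ w_2(v_2+y_1,y_2); Q_cl and the storage function are as displayed. *)

(* Defs.v *)
From HB Require Import structures.
From mathcomp Require Import all_boot all_order all_algebra.
From mathcomp Require Import all_classical all_reals all_analysis.
From mathcomp Require Import ring.

Set Implicit Arguments.
Unset Strict Implicit.
Unset Printing Implicit Defensive.

Import Order.TTheory GRing.Theory Num.Theory.
Import numFieldNormedType.Exports.

Local Open Scope classical_set_scope.
Local Open Scope ring_scope.

Definition dotv {R : realType} {n : nat} (a b : 'cV[R]_n) : R :=
  (a^T *m b) 0 0.

Definition quad_form {R : realType} {n : nat} (A : 'M[R]_n) (z : 'cV[R]_n) : R :=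
  dotv z (A *m z).

Definition negative_definite {R : realType} {n : nat} (A : 'M[R]_n) : Prop :=
  forall z, z != 0 -> quad_form A z < 0.

Definition sign_indefinite {R : realType} {n : nat} (A : 'M[R]_n) : Prop :=
  (exists z, 0 < quad_form A z) /\ (exists z, quad_form A z < 0).

Definition locally_lipschitz {R : realType} {a b : nat}
    (F : 'cV[R]_a -> 'cV[R]_b) : Prop :=
  forall x : 'cV[R]_a,
    exists2 U : set 'cV[R]_a, nbhs x U & [lipschitz F z | z in U].

Definition grad {R : realType} {n : nat} (V : 'cV[R]_n -> R) (x : 'cV[R]_n) :
    'cV[R]_n :=
  \col_i 'D_(delta_mx i 0) V x.

Definition cont_differentiable {R : realType} {n : nat} (V : 'cV[R]_n -> R) :
    Prop :=
  (forall x, differentiable V x) /\ continuous (grad V).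

Definition strictly_convex {R : realType} {n : nat} (V : 'cV[R]_n -> R) : Prop :=
  forall x z, x != z -> 0 < dotv (grad V x - grad V z) (x - z).

Definition strongly_convex {R : realType} {n : nat} (V : 'cV[R]_n -> R) : Prop :=
  exists2 mu : R, 0 < mu &
    forall x z, mu * dotv (x - z) (x - z) <= dotv (grad V x - grad V z) (x - z).

Record system (R : realType) (n m p : nat) := System {
  sys_f : 'cV[R]_n -> 'cV[R]_n;
  sys_G : 'M[R]_(n, m);
  sys_h : 'cV[R]_n -> 'cV[R]_p;
  sys_J : 'M[R]_(p, m) }.

Section Systems.
Context {R : realType} {n m p : nat}.
Implicit Types (Sg : system R n m p) (x xb : 'cV[R]_n) (u : 'cV[R]_m).

Definition rate Sg x u : 'cV[R]_n := sys_f Sg x + sys_G Sg *m u.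
Definition output Sg x u : 'cV[R]_p := sys_h Sg x + sys_J Sg *m u.

(* Measurable signals [0, oo[ -> R^k that are square integrable on every
   [0, T]; values at negative times are irrelevant. *)
Definition L2e {k : nat} (u : R -> 'cV[R]_k) : Prop :=
  (forall i, measurable_fun (`[0, +oo[%classic : set R) (fun t => u t i 0)) /\
  (forall T : R,
     (\int[lebesgue_measure]_(s in `[0%R, T]) (dotv (u s) (u s))%:E < +oo)%E).

(* Caratheodory solutions on [0, T[, with T possibly +oo. *)
Definition trajectory Sg (T : \bar R) (u : R -> 'cV[R]_m) (x : R -> 'cV[R]_n) :
    Prop :=
  {within [set t : R | 0 <= t /\ (t%:E < T)%E], continuous x} /\
  forall (t : R) i, 0 <= t -> (t%:E < T)%E ->
    lebesgue_measure.-integrable `[0, t]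
      (fun s => (rate Sg (x s) (u s) i 0)%:E) /\
    x t i 0 = x 0 i 0 +
      \int[lebesgue_measure]_(s in `[0, t]) rate Sg (x s) (u s) i 0.

(* Trajectories are unique because f is locally Lipschitz, so it suffices to
   ask for one global trajectory per initial condition and input. *)
Definition forward_complete Sg : Prop :=
  forall x0 (u : R -> 'cV[R]_m), L2e u ->
    exists x : R -> 'cV[R]_n,
      [/\ x 0 = x0, trajectory Sg +oo%E u x &
          L2e (fun t => output Sg (x t) (u t))].

Definition standing_assumptions Sg : Prop :=
  [/\ (m <= n)%N /\ (p <= n)%N, \rank (sys_G Sg) = m,
      locally_lipschitz (sys_f Sg), locally_lipschitz (sys_h Sg) &
      forward_complete Sg].

Definition equilibria Sg : set 'cV[R]_n :=
  [set xb | exists ub, sys_f Sg xb + sys_G Sg *m ub = 0].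

Definition k_u Sg xb : 'cV[R]_m :=
  - (invmx ((sys_G Sg)^T *m sys_G Sg) *m (sys_G Sg)^T *m sys_f Sg xb).

Definition k_y Sg xb : 'cV[R]_p := sys_h Sg xb + sys_J Sg *m k_u Sg xb.

Definition eq_relation Sg : set ('cV[R]_m * 'cV[R]_p) :=
  [set uy | exists xb, [/\ equilibria Sg xb, uy.1 = k_u Sg xb &
                           uy.2 = k_y Sg xb]].

Definition eq_outputs Sg (ub : 'cV[R]_m) : set 'cV[R]_p :=
  [set yb | eq_relation Sg (ub, yb)].

Definition eq_indep_observable Sg : Prop :=
  forall xb, equilibria Sg xb ->
    forall x : R -> 'cV[R]_n,
      trajectory Sg +oo%E (fun=> k_u Sg xb) x ->
      (forall t, 0 <= t ->
         sys_h Sg (x t) + sys_J Sg *m k_u Sg xb = k_y Sg xb) ->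
      forall t, 0 <= t -> x t = xb.

End Systems.

Record supply (R : realType) (m p : nat) := Supply {
  sup_Q : 'M[R]_p;
  sup_S : 'M[R]_(p, m);
  sup_R : 'M[R]_m }.

Definition supply_symmetric {R : realType} {m p : nat} (w : supply R m p) :
    Prop :=
  (sup_Q w)^T = sup_Q w /\ (sup_R w)^T = sup_R w.

Definition supply_mx {R : realType} {m p : nat} (w : supply R m p) :
    'M[R]_(p + m) :=
  block_mx (sup_Q w) (sup_S w) (sup_S w)^T (sup_R w).

Definition supply_rate {R : realType} {m p : nat} (w : supply R m p)
    (u : 'cV[R]_m) (y : 'cV[R]_p) : R :=
  dotv y (sup_Q w *m y) + 2 * dotv y (sup_S w *m u) + dotv u (sup_R w *m u).

Section Dissipativity.
Context {R : realType} {n m p : nat}.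
Implicit Types (Sg : system R n m p) (w : supply R m p).

(* V xb is the storage function V_xb.  The inequality is required along
   trajectories on any horizon, global or not: completeness of a feedback
   interconnection is not automatic. *)
Definition EID Sg w (V : 'cV[R]_n -> 'cV[R]_n -> R) : Prop :=
  forall xb, equilibria Sg xb ->
    [/\ forall x, 0 <= V xb x, cont_differentiable (V xb), V xb xb = 0 &
      forall (T : \bar R) (u : R -> 'cV[R]_m) (x : R -> 'cV[R]_n),
        L2e u -> trajectory Sg T u x ->
        forall t, 0 <= t -> (t%:E < T)%E ->
          dotv (grad (V xb) (x t)) (sys_f Sg (x t) + sys_G Sg *m u t) <=
          supply_rate w (u t - k_u Sg xb) (output Sg (x t) (u t) - k_y Sg xb)].

Definition EID_Hill_Moylan Sg (V : 'cV[R]_n -> R) w : Prop :=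
  let f := sys_f Sg in let G := sys_G Sg in
  let h := sys_h Sg in let J := sys_J Sg in
  let Q := sup_Q w in let S := sup_S w in
  [/\ forall x, 0 <= V x, cont_differentiable V, convex_function [set: 'cV[R]_n] V &
    exists (k : nat) (W : 'M[R]_(k, m)) (l : 'cV[R]_n -> 'cV[R]_n -> 'cV[R]_k),
      [/\ (0 < k)%N,
        forall x xb, equilibria Sg xb ->
          dotv (grad V x - grad V xb) (f x - f xb) =
          dotv (h x - h xb) (Q *m (h x - h xb)) - dotv (l x xb) (l x xb),
        forall x xb, equilibria Sg xb ->
          2^-1 *: ((grad V x - grad V xb)^T *m G) =
          (h x - h xb)^T *m (Q *m J + S) - (l x xb)^T *m W &
        W^T *m W = sup_R w + J^T *m S + S^T *m J + J^T *m Q *m J]].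

End Dissipativity.

Section Stability.
Context {R : realType} {n m p : nat}.
Variables (Sg : system R n m p) (vb : 'cV[R]_m) (xb : 'cV[R]_n).

Definition unique_equilibrium : Prop :=
  forall x, sys_f Sg x + sys_G Sg *m vb = 0 <-> x = xb.

Definition stable : Prop :=
  forall e : R, 0 < e -> exists2 d : R, 0 < d &
    forall (T : \bar R) (x : R -> 'cV[R]_n),
      trajectory Sg T (fun=> vb) x -> `|x 0 - xb| < d ->
      forall t, 0 <= t -> (t%:E < T)%E -> `|x t - xb| < e.

Definition attracted (x0 : 'cV[R]_n) : Prop :=
  (exists2 x : R -> 'cV[R]_n, trajectory Sg +oo%E (fun=> vb) x & x 0 = x0) /\
  forall x : R -> 'cV[R]_n, trajectory Sg +oo%E (fun=> vb) x -> x 0 = x0 ->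
    x t @[t --> +oo] --> xb.

Definition locally_asymptotically_stable : Prop :=
  stable /\
  exists2 d : R, 0 < d & forall x0, `|x0 - xb| < d -> attracted x0.

Definition globally_asymptotically_stable : Prop :=
  stable /\ forall x0, attracted x0.

End Stability.

Section Feedback.
Context {R : realType} {n1 n2 m p : nat}.
Variables (S1 : system R n1 m p) (S2 : system R n2 p m).

(* Solving u1 = v1 - y2, u2 = v2 + y1, yi = hi + Ji ui for y1 gives
   (I + J1 J2) y1 = h1 - J1 h2 + J1 v1 - J1 J2 v2, and then y2 = h2 + J2 u2.
   cl_hi and cl_Ji are the resulting free terms and feedthroughs of yi. *)
Definition cl_M : 'M[R]_p := invmx (1%:M + sys_J S1 *m sys_J S2).

Definition cl_h1 (x1 : 'cV[R]_n1) (x2 : 'cV[R]_n2) : 'cV[R]_p :=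
  cl_M *m (sys_h S1 x1 - sys_J S1 *m sys_h S2 x2).
Definition cl_J1 : 'M[R]_(p, m + p) :=
  cl_M *m row_mx (sys_J S1) (- (sys_J S1 *m sys_J S2)).

Definition cl_h2 (x1 : 'cV[R]_n1) (x2 : 'cV[R]_n2) : 'cV[R]_m :=
  sys_h S2 x2 + sys_J S2 *m cl_h1 x1 x2.
Definition cl_J2 : 'M[R]_(m, m + p) :=
  sys_J S2 *m (row_mx 0 1%:M + cl_J1).

(* State (x1, x2), input (v1, v2), output (y1, y2). *)
Definition closed_loop : system R (n1 + n2) (m + p) (p + m) :=
  @System R (n1 + n2) (m + p) (p + m)
    (fun x => let x1 := usubmx x in let x2 := dsubmx x in
       col_mx (sys_f S1 x1 - sys_G S1 *m cl_h2 x1 x2)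
              (sys_f S2 x2 + sys_G S2 *m cl_h1 x1 x2))
    (col_mx (sys_G S1 *m (row_mx 1%:M 0 - cl_J2))
            (sys_G S2 *m (row_mx 0 1%:M + cl_J1)))
    (fun x => let x1 := usubmx x in let x2 := dsubmx x in
       col_mx (cl_h1 x1 x2) (cl_h2 x1 x2))
    (col_mx cl_J1 cl_J2).

Variables (w1 : supply R m p) (w2 : supply R p m).

(* The coefficients of w1(v1 - y2, y1) + kappa w2(v2 + y1, y2), as checked in
   supply_rate_cl below; this forces the sign of R1 and the factors kappa in the
   blocks of S and R. *)
Definition supply_cl (kappa : R) : supply R (m + p) (p + m) :=
  @Supply R (m + p) (p + m)
    (block_mx (sup_Q w1 + kappa *: sup_R w2)
              (- sup_S w1 + kappa *: (sup_S w2)^T)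
              (- (sup_S w1)^T + kappa *: sup_S w2)
              (sup_R w1 + kappa *: sup_Q w2))
    (block_mx (sup_S w1) (kappa *: sup_R w2)
              (- sup_R w1) (kappa *: sup_S w2))
    (block_mx (sup_R w1) 0 0 (kappa *: sup_R w2)).

End Feedback.

Definition bregman {R : realType} {n : nat} (V : 'cV[R]_n -> R)
    (xb x : 'cV[R]_n) : R :=
  V x - V xb - dotv (grad V xb) (x - xb).

Definition storage_cl {R : realType} {n1 n2 : nat}
    (V1 : 'cV[R]_n1 -> R) (V2 : 'cV[R]_n2 -> R) (kappa : R)
    (xb x : 'cV[R]_(n1 + n2)) : R :=
  bregman V1 (usubmx xb) (usubmx x) + kappa * bregman V2 (dsubmx xb) (dsubmx x).

Lemma full_col_rankP (R : realType) (n m : nat) (G : 'M[R]_(n, m)) :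
  \rank G = m <-> (forall u : 'cV_m, G *m u = 0 -> u = 0).
Proof.
split=> [rG u Gu|inj].
  have Gf : row_free G^T by rewrite /row_free mxrank_tr rG.
  by apply: trmx_inj; apply: (row_free_inj Gf); rewrite -trmx_mul Gu !trmx0 mul0mx.
apply/eqP; rewrite -mxrank_tr -/(row_free _) -kermx_eq0.
apply/rowV0P => v /sub_kermxP v0.
apply: trmx_inj; rewrite trmx0; apply: inj; apply: trmx_inj.
by rewrite trmx_mul trmxK v0 trmx0.
Qed.

Lemma k_u_unique (R : realType) (n m p : nat) (Sg : system R n m p) xb ub :
  \rank (sys_G Sg) = m -> sys_f Sg xb + sys_G Sg *m ub = 0 -> ub = k_u Sg xb.
Proof.
move=> rG /eqP; rewrite addr_eq0 => /eqP fE.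
have dot0 k (a : 'rV[R]_k) : a *m a^T = 0 -> a = 0.
  move/matrixP/(_ 0 0); rewrite !mxE => /eqP.
  under eq_bigr do rewrite mxE -expr2.
  rewrite psumr_eq0 => [|i _]; last exact: sqr_ge0.
  move=> /allP a0; apply/rowP => j; rewrite mxE.
  have := a0 j (mem_index_enum _); rewrite sqrf_eq0 => /eqP //.
have GtG : (sys_G Sg)^T *m sys_G Sg \in unitmx.
  rewrite -row_free_unit -kermx_eq0; apply/rowV0P => v /sub_kermxP v0.
  have Gf : row_free (sys_G Sg)^T by rewrite /row_free mxrank_tr rG.
  apply: (row_free_inj Gf); rewrite mul0mx; apply: dot0.
  by rewrite trmx_mul trmxK mulmxA -(mulmxA v) v0 mul0mx.
by rewrite /k_u fE mulmxN opprK -mulmxA [X in _ *m X]mulmxA mulKmx.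
Qed.

Section FeedbackTheory.
Context {R : realType} {n1 n2 m p : nat}.
Variables (S1 : system R n1 m p) (S2 : system R n2 p m).
Hypothesis wp : 1%:M + sys_J S1 *m sys_J S2 \in unitmx.
Let C := closed_loop S1 S2.

Lemma closed_loop_outputE x1 x2 v1 v2 :
  output C (col_mx x1 x2) (col_mx v1 v2) =
  col_mx (cl_h1 S1 S2 x1 x2 + cl_J1 S1 S2 *m col_mx v1 v2)
         (cl_h2 S1 S2 x1 x2 + cl_J2 S1 S2 *m col_mx v1 v2).
Proof. by rewrite /output /= col_mxKu col_mxKd mul_col_mx add_col_mx. Qed.

Lemma closed_loop_outputP x1 x2 v1 v2 y1 y2 :
  output C (col_mx x1 x2) (col_mx v1 v2) = col_mx y1 y2 <->
  y1 = output S1 x1 (v1 - y2) /\ y2 = output S2 x2 (v2 + y1).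
Proof.
rewrite closed_loop_outputE.
have E1 : cl_h1 S1 S2 x1 x2 + cl_J1 S1 S2 *m col_mx v1 v2 =
    cl_M S1 S2 *m (sys_h S1 x1 - sys_J S1 *m sys_h S2 x2
      + sys_J S1 *m v1 - sys_J S1 *m sys_J S2 *m v2).
  by rewrite /cl_h1 /cl_J1 -mulmxA mul_row_col -mulmxDr mulNmx !addrA.
have E2 : cl_h2 S1 S2 x1 x2 + cl_J2 S1 S2 *m col_mx v1 v2 =
    output S2 x2 (v2 + (cl_h1 S1 S2 x1 x2 + cl_J1 S1 S2 *m col_mx v1 v2)).
  rewrite /cl_h2 /cl_J2 /output -mulmxA mulmxDl mul_row_col mul0mx mul1mx add0r.
  by rewrite -addrA -mulmxDr addrCA.
rewrite E2 E1; split.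
  move/eq_col_mx => [<- <-]; split=> //.
  set z := (X in _ *m X); set y := _ *m z.
  have : (1%:M + sys_J S1 *m sys_J S2) *m y = z by rewrite mulKVmx.
  rewrite mulmxDl mul1mx => /(canRL (addrK _)) yE; rewrite [LHS]yE; clearbody y.
  rewrite /output !mulmxBr !mulmxDr !mulmxA /z.
  set a := sys_h S1 x1; set b := _ *m sys_h S2 _;
  set c := _ *m v1; set d := _ *m v2; set e := _ *m y.
  by apply/matrixP=> i j; rewrite !mxE; ring.
move=> [e1 e2].
have {}e1 : y1 = cl_M S1 S2 *m (sys_h S1 x1 - sys_J S1 *m sys_h S2 x2
      + sys_J S1 *m v1 - sys_J S1 *m sys_J S2 *m v2).
  apply/(canRL (mulKmx wp)); rewrite mulmxDl mul1mx {1}e1 e2.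
  rewrite /output !mulmxBr !mulmxDr !mulmxA !opprD !addrA.
  set a := sys_h S1 x1; set b := _ *m sys_h S2 _;
  set c := _ *m v1; set d := _ *m v2; set e := _ *m y1.
  by apply/matrixP=> i j; rewrite !mxE; ring.
by rewrite -e1 -e2.
Qed.

Lemma closed_loop_rateE x1 x2 v1 v2 y1 y2 :
  output C (col_mx x1 x2) (col_mx v1 v2) = col_mx y1 y2 ->
  rate C (col_mx x1 x2) (col_mx v1 v2) =
  col_mx (rate S1 x1 (v1 - y2)) (rate S2 x2 (v2 + y1)).
Proof.
rewrite closed_loop_outputE => /eq_col_mx [<- <-].
rewrite /rate /= col_mxKu col_mxKd mul_col_mx add_col_mx.
rewrite -(mulmxA (sys_G S1)) -(mulmxA (sys_G S2)).
congr col_mx.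
  rewrite mulmxBl mul_row_col mul0mx mul1mx addr0 -addrA.
  by rewrite -(mulmxN _ (cl_h2 _ _ _ _)) -mulmxDr addrCA (opprD (cl_h2 _ _ _ _)).
by rewrite mulmxDl mul_row_col mul0mx mul1mx add0r -addrA -mulmxDr addrCA.
Qed.

End FeedbackTheory.

Section FeedbackEquilibria.
Context {R : realType} {n1 n2 m p : nat}.
Variables (S1 : system R n1 m p) (S2 : system R n2 p m).
Hypothesis wp : 1%:M + sys_J S1 *m sys_J S2 \in unitmx.
Hypotheses (r1 : \rank (sys_G S1) = m) (r2 : \rank (sys_G S2) = p).
Let C := closed_loop S1 S2.

Lemma closed_loop_rank : \rank (sys_G C) = (m + p)%N.
Proof.
apply/full_col_rankP => v.
pose T1 := @System R n1 m p (fun=> 0) (sys_G S1) (fun=> 0) (sys_J S1).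
pose T2 := @System R n2 p m (fun=> 0) (sys_G S2) (fun=> 0) (sys_J S2).
pose y := output (closed_loop T1 T2) (col_mx 0 0) v.
have := @closed_loop_rateE _ _ _ _ _ T1 T2 0 0 (usubmx v) (dsubmx v)
  (usubmx y) (dsubmx y).
have := @closed_loop_outputP _ _ _ _ _ T1 T2 wp 0 0 (usubmx v) (dsubmx v)
  (usubmx y) (dsubmx y).
rewrite !vsubmxK => -[/(_ erefl)[e1 e2] _] /(_ erefl) E Gv0.
have {E} : rate (closed_loop T1 T2) (col_mx 0 0) v = 0.
  rewrite /rate /= col_mxKu col_mxKd /cl_h2 /cl_h1 /= !mulmx0 subrr
    !mulmx0 addr0 !mulmx0 subrr addr0.
  by rewrite col_mx0 add0r; exact: Gv0.
have := @closed_loop_rateE _ _ _ _ _ T1 T2 0 0 (usubmx v) (dsubmx v)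
  (usubmx y) (dsubmx y).
rewrite !vsubmxK => /(_ erefl) ->.
rewrite -col_mx0 => /eq_col_mx []; rewrite /rate /= !add0r.
move=> /((full_col_rankP _).1 r1) a /((full_col_rankP _).1 r2) b.
move: e1 e2; rewrite /output /= a b !mulmx0 !addr0 => e1 e2.
move: a b; rewrite e1 e2 subr0 addr0 => a b.
by rewrite -[v]vsubmxK a b col_mx0.
Qed.

Lemma closed_loop_equilibriaP x1 x2 :
  equilibria C (col_mx x1 x2) <-> equilibria S1 x1 /\ equilibria S2 x2.
Proof.
split=> [[v]|[[u1 e1] [u2 e2]]].
  pose y := output C (col_mx x1 x2) v.
  have := @closed_loop_rateE _ _ _ _ _ S1 S2 x1 x2 (usubmx v) (dsubmx v)
    (usubmx y) (dsubmx y).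
  rewrite !vsubmxK => /(_ erefl) E; rewrite -/(rate C _ _) E -col_mx0.
  move=> /eq_col_mx [a b].
  by split; eexists; [exact: a|exact: b].
pose y1 := output S1 x1 u1; pose y2 := output S2 x2 u2.
exists (col_mx (u1 + y2) (u2 - y1)).
rewrite -/(rate C _ _) (@closed_loop_rateE _ _ _ _ _ _ _ _ _ _ _ y1 y2).
  by rewrite addrK subrK /rate e1 e2 col_mx0.
by apply/closed_loop_outputP => //; rewrite addrK subrK.
Qed.

Lemma closed_loop_k_u x1 x2 : equilibria S1 x1 -> equilibria S2 x2 ->
  k_u C (col_mx x1 x2) = col_mx (k_u S1 x1 + k_y S2 x2) (k_u S2 x2 - k_y S1 x1).
Proof.
move=> [u1 e1] [u2 e2].
have E1 := k_u_unique r1 e1; have E2 := k_u_unique r2 e2.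
apply/esym/(k_u_unique closed_loop_rank).
rewrite -/(rate C _ _).
rewrite (@closed_loop_rateE _ _ _ _ _ _ _ _ _ _ _ (k_y S1 x1) (k_y S2 x2)).
  by rewrite addrK subrK -E1 -E2 /rate e1 e2 col_mx0.
by apply/closed_loop_outputP => //; rewrite addrK subrK.
Qed.

End FeedbackEquilibria.

Lemma dotvC (R : realType) n (a b : 'cV[R]_n) : dotv a b = dotv b a.
Proof. by rewrite /dotv -[in LHS](trmxK b) -trmx_mul mxE. Qed.

Lemma dotv_col (R : realType) n k (a c : 'cV[R]_n) (b d : 'cV[R]_k) :
  dotv (col_mx a b) (col_mx c d) = dotv a c + dotv b d.
Proof. by rewrite /dotv tr_col_mx mul_row_col mxE. Qed.

Lemma dotvDr (R : realType) n (a b c : 'cV[R]_n) :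
  dotv a (b + c) = dotv a b + dotv a c.
Proof. by rewrite /dotv mulmxDr mxE. Qed.

Lemma dotvDl (R : realType) n (a b c : 'cV[R]_n) :
  dotv (b + c) a = dotv b a + dotv c a.
Proof. by rewrite dotvC dotvDr !(dotvC a). Qed.

Lemma dotvNr (R : realType) n (a b : 'cV[R]_n) : dotv a (- b) = - dotv a b.
Proof. by rewrite /dotv mulmxN mxE. Qed.

Lemma dotvNl (R : realType) n (a b : 'cV[R]_n) : dotv (- a) b = - dotv a b.
Proof. by rewrite dotvC dotvNr dotvC. Qed.

Lemma dotvZr (R : realType) n k (a b : 'cV[R]_n) : dotv a (k *: b) = k * dotv a b.
Proof. by rewrite /dotv -scalemxAr mxE. Qed.

Lemma dotv0r (R : realType) n (a : 'cV[R]_n) : dotv a 0 = 0.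
Proof. by rewrite /dotv mulmx0 mxE. Qed.

Lemma dotvT (R : realType) n k (A : 'M[R]_(n, k)) a b :
  dotv a (A *m b) = dotv b (A^T *m a).
Proof. by rewrite dotvC /dotv trmx_mul mulmxA. Qed.

Lemma supply_rate_cl (R : realType) m p (w1 : supply R m p) (w2 : supply R p m)
    kappa v1 v2 y1 y2 :
  supply_symmetric w1 -> supply_symmetric w2 ->
  supply_rate (supply_cl w1 w2 kappa) (col_mx v1 v2) (col_mx y1 y2) =
  supply_rate w1 (v1 - y2) y1 + kappa * supply_rate w2 (v2 + y1) y2.
Proof.
case: w1 w2 => Q1 S1 R1 [Q2 S2 R2] [/= _ r1] [/= _ r2].
rewrite /supply_rate /= !mul_block_col !dotv_col.
rewrite !(mulmxDl, mulmxDr, mulmxN, mulNmx, dotvDr, dotvDl, dotvNr, dotvNl,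
  dotvZr, mul0mx, dotv0r, opprD, opprK) -?scalemxAl ?dotvZr.
rewrite (dotvT S1^T) (dotvT S2^T) !trmxK.
rewrite (dotvT R1 v1 y2) (dotvT R2 v2 y1) r1 r2.
ring.
Qed.

(* Main.v *)
Require Import Defs.
From mathcomp Require Import all_boot all_order all_algebra.
From mathcomp Require Import all_classical all_reals all_analysis.
From mathcomp Require Import ring lra.
Set Implicit Arguments.
Unset Strict Implicit.
Unset Printing Implicit Defensive.
Import Order.TTheory GRing.Theory Num.Theory.
Import numFieldNormedType.Exports.
Local Open Scope classical_set_scope.
Local Open Scope ring_scope.

(** A Hill-Moylan identity completes the square in the dissipation inequality of
each subsystem relative to an equilibrium, with the Bregman divergence of [V_i]
as storage; substituting the interconnection adds these inequalities up to one
for the closed loop. With constant inputs and [Q_cl < 0], the storage [B] is then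
a Lyapunov function that decreases strictly unless the output is at equilibrium,
and observability excludes any other solution on which [B] is constant.

LaSalle's argument is run on a globally Lipschitz field that agrees with the
closed loop on a sublevel set of [B]: Picard's iteration gives its solutions and
a Gronwall estimate transports the constancy of [B] on a limit set to the
solution through a limit point. *)

(** Forward completeness of the two subsystems does not pass automatically to their interconnection,
    so global closed-loop solutions have to be produced as well as shown to converge. For this
    reason the field is truncated outside a sublevel set of [B], which is both invariant and
    bounded.

    Boundedness comes from convexity. A Bregman divergence at [xb] satisfies
    [b (xb + t (x - xb)) <= t b x] for [0 <= t <= 1]; its minimum on a sphere around [xb], positive
    under strict convexity, therefore forces at least linear growth outside that sphere. The same
    bound shows that small sublevel sets shrink to [xb].

    Uniqueness of the equilibrium does not use the Lyapunov function: the unique equilibrium outputs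
    fix the input of each subsystem, and observability, applied to constant trajectories, then fixes
    the states. *)

(** * Column vectors with the maximum norm *)

Section ColumnVectors.
Context {R : realType}.

Lemma norm_cV_le n (v : 'cV[R]_n) (c : R) : 0 <= c ->
  `|v| <= c <-> forall i, `|v i 0| <= c.
Proof.
move=> c0; rewrite [`|v|]mx_normrE; split=> [vc i|vc].
  by apply: le_trans vc; exact: (le_bigmax _ (fun ij => `|v ij.1 ij.2|) (i, 0)).
by apply/bigmax_leP; split=> // -[i j] _ /=; rewrite ord1.
Qed.

Lemma norm_coord_le n (v : 'cV[R]_n) i : `|v i 0| <= `|v|.
Proof. by move: i; apply/(norm_cV_le v). Qed.

Lemma cvg_cV n (T : Type) (F : set_system T) (FF : Filter F)
    (f : T -> 'cV[R]_n) (l : 'cV[R]_n) :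
  (forall i, f x i 0 @[x --> F] --> l i 0) -> f x @[x --> F] --> l.
Proof.
move=> fl; apply/cvgrPdist_le => e e0; near=> x.
apply/norm_cV_le; first exact: ltW.
move=> i; rewrite !mxE; move: i; near: x; apply: filter_forall => i.
exact: ((cvgrPdist_le _ _).1 (fl i)).
Unshelve. all: by end_near. Qed.

Lemma near_norm_le (V : normedModType R) (x : V) (e : R) :
  0 < e -> \forall y \near x, `|x - y| <= e.
Proof.
move=> e0; apply/nbhs_ballP; exists e => //= y.
by rewrite -ball_normE /= => /ltW.
Qed.

Lemma lipschitz1_continuous n k (f : 'cV[R]_n -> 'cV[R]_k) (C : R) :
  (forall x y, `|f x - f y| <= C * `|x - y|) -> continuous f.
Proof.
move=> fC x; apply/(@cvgrPdist_le _ _ _ _ (nbhs_filter x)) => e e0; near=> y.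
apply: (le_trans (fC _ _)).
apply: (@le_trans _ _ ((`|C| + 1) * `|x - y|)).
  by apply: ler_wpM2r => //; rewrite (le_trans (ler_norm _)) // lerDl.
rewrite mulrC -ler_pdivlMr ?ltr_wpDl //.
near: y; apply: (near_norm_le (V := 'cV[R]_n)).
by rewrite divr_gt0 // ltr_wpDl.
Unshelve. all: by end_near. Qed.

Lemma norm_mulmx_le n k (M : 'M[R]_(k, n)) :
  exists2 C, 0 <= C & forall v : 'cV[R]_n, `|M *m v| <= C * `|v|.
Proof.
exists (\sum_i \sum_j `|M i j|).
  by do 2! apply: sumr_ge0 => ? _.
move=> v; apply/norm_cV_le.
  by rewrite mulr_ge0 //; do 2! apply: sumr_ge0 => ? _.
move=> i; rewrite mxE (le_trans (ler_norm_sum _ _ _)) //.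
apply: (@le_trans _ _ ((\sum_j `|M i j|) * `|v|)).
  rewrite mulr_suml; apply: ler_sum => j _.
  by rewrite normrM ler_wpM2l // norm_coord_le.
apply: ler_wpM2r => //.
rewrite [leRHS](bigD1 i) //= lerDl.
by do 2! apply: sumr_ge0 => ? _.
Qed.

Lemma norm_usubmx_le n k (v : 'cV[R]_(n + k)) : `|usubmx v| <= `|v|.
Proof. by apply/norm_cV_le => // i; rewrite mxE norm_coord_le. Qed.

Lemma norm_dsubmx_le n k (v : 'cV[R]_(n + k)) : `|dsubmx v| <= `|v|.
Proof. by apply/norm_cV_le => // i; rewrite mxE norm_coord_le. Qed.

Lemma norm_col_mx_le n k (a : 'cV[R]_n) (b : 'cV[R]_k) (c : R) :
  `|a| <= c -> `|b| <= c -> `|col_mx a b| <= c.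
Proof.
move=> ac bc; have c0 : 0 <= c by apply: le_trans ac.
by apply/norm_cV_le => // i; rewrite mxE; case: (fintype.split i) => j;
  rewrite (le_trans (norm_coord_le _ _)).
Qed.

Lemma usubmx_continuous n k : continuous (usubmx : 'cV[R]_(n + k) -> 'cV[R]_n).
Proof.
apply: (@lipschitz1_continuous _ _ _ 1) => x y.
by rewrite -linearB mul1r norm_usubmx_le.
Qed.

Lemma dsubmx_continuous n k : continuous (dsubmx : 'cV[R]_(n + k) -> 'cV[R]_k).
Proof.
apply: (@lipschitz1_continuous _ _ _ 1) => x y.
by rewrite -linearB mul1r norm_dsubmx_le.
Qed.

(** Heine-Borel for row vectors is carried over by transposition, which is continuous and preserves
    the entrywise norm. *)
Lemma compact_cV n (A : set 'cV[R]_n) : bounded_set A -> closed A -> compact A.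
Proof.
move=> [M [Mr AM]] Acl.
have trC k l : continuous (trmx : 'M[R]_(k, l) -> 'M[R]_(l, k)).
  move=> x; apply/(@cvgrPdist_le _ _ _ _ (nbhs_filter x)) => e e0.
  near=> y; rewrite -linearB /= [leLHS]mx_normrE; apply/bigmax_leP; split=> [|[i j] _ /=].
    exact: ltW.
  rewrite mxE; apply: (@le_trans _ _ `|x - y|); last first.
    by near: y; exact: (near_norm_le (V := 'M[R]_(k, l))).
  rewrite [leRHS]mx_normrE.
  exact: (le_bigmax _ (fun ij => `|(x - y) ij.1 ij.2|) (j, i)).
have -> : A = trmx @` (trmx @^-1` A).
  apply/seteqP; split=> [v Av|_ [w /= Aw <-] //].
  by exists v^T; rewrite /= ?trmxK.
apply: continuous_compact; first exact/continuous_subspaceT/trC.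
apply: bounded_closed_compact.
  exists M; split=> // y My v /= Av.
  apply: le_trans (AM _ My _ Av).
  rewrite [leLHS]mx_normrE; apply/bigmax_leP; split=> [|[i j] _ /=] //.
  by rewrite ord1; have := norm_coord_le v^T j; rewrite mxE.
by apply: closed_comp Acl => x _; exact: trC.
Unshelve. all: by end_near. Qed.

End ColumnVectors.

(** * Chain rule, mean value inequalities and antiderivatives *)

Section Calculus.
Context {R : realType}.

Lemma derive_grad n (V : 'cV[R]_n -> R) (x v : 'cV[R]_n) :
  differentiable V x -> 'D_v V x = dotv (grad V x) v.
Proof.
move=> dV; rewrite deriveE //.
have {1}-> : v = \sum_i v i 0 *: delta_mx i 0.
  rewrite [LHS]matrix_sum_delta; apply: eq_bigr => i _.
  by rewrite big_ord1.
rewrite linear_sum /dotv mxE; apply: eq_bigr => i _.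
by rewrite linearZ /= !mxE deriveE // mulrC.
Qed.

Lemma is_derive_cV n (x : R -> 'cV[R]_n) (t : R) (d : 'cV[R]_n) :
  is_derive t 1 x d <-> forall i, is_derive t 1 (fun s => x s i 0) (d i 0).
Proof.
split=> [[dx xd] i|xd].
  split; first by move/derivable_mxP: dx; exact.
  by rewrite -xd derive_mx // mxE.
have dx : derivable x t 1.
  by apply/derivable_mxP => i j; rewrite ord1; case: (xd i).
split=> //; apply/matrixP => i j; rewrite derive_mx // mxE ord1.
by case: (xd i).
Qed.

Lemma is_derive_grad n (V : 'cV[R]_n -> R) (x : R -> 'cV[R]_n) t d :
  differentiable V (x t) -> is_derive t 1 x d ->
  is_derive t 1 (V \o x) (dotv (grad V (x t)) d).
Proof.
move=> dV [/derivable1_diffP dx xd].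
have dVx : differentiable (V \o x) t by exact: differentiable_comp.
split; first exact/derivable1_diffP.
rewrite deriveE // diff_comp //= -derive_grad // [RHS]deriveE // -xd.
by congr ('d V _ _); rewrite deriveE.
Qed.

Lemma le0_derive_le (f df : R -> R) (a b : R) : a <= b ->
  {within `[a, b], continuous f} ->
  (forall s, a < s < b -> is_derive s 1 f (df s)) ->
  (forall s, a < s < b -> df s <= 0) -> f b <= f a.
Proof.
rewrite le_eqVlt => /predU1P[-> //|ab] cf dfE df0.
have [s /[!in_itv]/= sab fE] : exists2 c, c \in `]a, b[ &
    f b - f a = df c * (b - a).
  by apply: MVT => // s; rewrite in_itv; exact: dfE.
by rewrite -subr_le0 fE pmulr_lle0 ?subr_gt0 // df0.
Qed.

Lemma coord_continuous n (i : 'I_n) : continuous (fun v : 'cV[R]_n => v i 0).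
Proof. by move=> v; exact/differentiable_continuous/differentiable_coord. Qed.

Lemma within_continuous_coord n (A : set R) (x : R -> 'cV[R]_n) i :
  {within A, continuous x} -> {within A, continuous (fun s => x s i 0)}.
Proof.
move=> cx s.
apply: (@cvg_comp _ _ _ x (fun v => v i 0) _ (nbhs (x s)) _ (cx s)).
exact: coord_continuous.
Qed.

(** For the maximum norm the vector inequality splits into coordinates: [g_i - psi] and
    [- psi - g_i] are both nonincreasing. *)
Lemma norm_derive_le n (g dg : R -> 'cV[R]_n) (psi dpsi : R -> R) (t : R) :
  0 <= t ->
  {within `[0, t], continuous g} -> {within `[0, t], continuous psi} ->
  (forall s, 0 < s < t -> is_derive s 1 g (dg s)) ->
  (forall s, 0 < s < t -> is_derive s 1 psi (dpsi s)) ->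
  (forall s, 0 < s < t -> `|dg s| <= dpsi s) ->
  `|g t - g 0| <= psi t - psi 0.
Proof.
move=> t0 cg cpsi dgE dpsiE dle.
have cgi i : {within `[0, t], continuous (fun s => g s i 0)}.
  exact: within_continuous_coord.
have psi0 : 0 <= psi t - psi 0.
  rewrite subr_ge0 -[psi t]opprK lerNr.
  apply: (@le0_derive_le (fun s => - psi s) (fun s => - dpsi s) 0 t) => //.
  - by move=> s; apply: cvgN; exact: cpsi.
  - by move=> s /dpsiE ?; exact: is_deriveN.
  - by move=> s /dle /(le_trans (normr_ge0 _)); rewrite oppr_le0.
have dgi s i : 0 < s < t -> is_derive s 1 (fun s => g s i 0) (dg s i 0).
  by move=> /dgE /is_derive_cV.
apply/norm_cV_le => // i; rewrite !mxE ler_norml; apply/andP; split.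
  rewrite -subr_le0.
  have /= := @le0_derive_le (fun s => - psi s - g s i 0)
    (fun s => - dpsi s - dg s i 0) 0 t t0.
  have P : {within `[0, t], continuous (fun s => - psi s - g s i 0)}.
    by move=> s; apply: cvgB; [apply: cvgN; exact: cpsi|exact: cgi].
  have Q s : 0 < s < t ->
      is_derive s 1 (fun s => - psi s - g s i 0) (- dpsi s - dg s i 0).
    move=> st; have ? := dpsiE _ st; have ? := dgi _ i st.
    by apply: is_deriveB.
  move=> /(_ P Q) H; suff : - psi t - g t i 0 <= - psi 0 - g 0 i 0 by lra.
  apply: H => s /dle; have := ler_norm (- dg s i 0); rewrite normrN.
  have := norm_coord_le (dg s) i; lra.
have P : {within `[0, t], continuous (fun s => g s i 0 - psi s)}.
  by move=> s; apply: cvgB; [exact: cgi|exact: cpsi].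
have Q s : 0 < s < t ->
    is_derive s 1 (fun s => g s i 0 - psi s) (dg s i 0 - dpsi s).
  move=> st; have ? := dpsiE _ st; have ? := dgi _ i st.
  by apply: is_deriveB.
have := @le0_derive_le _ _ 0 t t0 P Q.
suff: forall s, 0 < s < t -> dg s i 0 - dpsi s <= 0 by move=> d0 /(_ d0) /=; lra.
move=> s /dle; have := ler_norm (dg s i 0).
have := norm_coord_le (dg s) i; lra.
Qed.

(* The weight [expR (2 L t)] makes Picard's operator a contraction on the whole
   half-line, and closes Gronwall's estimate without an integral. *)
Lemma norm_derive_le_expR n (g dg : R -> 'cV[R]_n) (C L t : R) :
  0 <= t -> 0 < L -> 0 <= C ->
  {within `[0, t], continuous g} ->
  (forall s, 0 < s < t -> is_derive s 1 g (dg s)) ->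
  (forall s, 0 < s < t -> `|dg s| <= L * (C * expR (2 * L * s))) ->
  `|g t - g 0| <= C / 2 * expR (2 * L * t).
Proof.
move=> t0 L0 C0 cg dgE dle.
have dexp (s : R) : is_derive s 1 (fun s : R => C / 2 * expR (2 * L * s))
    (L * (C * expR (2 * L * s))).
  have ? : is_derive s (1 : R) (fun s : R => expR (2 * L * s))
      (expR (2 * L * s) * (2 * L)).
    apply: (@is_derive1_comp _ expR (fun s => 2 * L * s)).
    apply: is_derive_eq (is_deriveZ (2 * L) (is_derive_id s 1)) _.
    exact: mulr1.
  have -> : L * (C * expR (2 * L * s)) = (C / 2) *: (expR (2 * L * s) * (2 * L)).
    by rewrite /GRing.scale /=; field.
  exact: (@is_deriveZ _ _ _ (fun s : R => expR (2 * L * s))).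
apply: le_trans (norm_derive_le t0 cg _ dgE (fun s _ => dexp s) dle) _.
  apply: continuous_subspaceT => s.
  by apply/differentiable_continuous/derivable1_diffP; case: (dexp s).
by rewrite lerBlDr lerDl mulr_ge0 ?expR_ge0 // divr_ge0.
Qed.

(** The constant [C] comes back halved. This half is the contraction factor of Picard's iteration,
    and it lets the weighted maximum be absorbed in Gronwall's estimate. *)
Lemma dist_derive_le_expR n (y z dy dz : R -> 'cV[R]_n) (C L t : R) :
  0 <= t -> 0 < L -> 0 <= C ->
  {within `[0, t], continuous y} -> {within `[0, t], continuous z} ->
  (forall s, 0 < s < t -> is_derive s 1 y (dy s)) ->
  (forall s, 0 < s < t -> is_derive s 1 z (dz s)) ->
  (forall s, 0 < s < t -> `|dy s - dz s| <= L * (C * expR (2 * L * s))) ->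
  `|y t - z t| <= `|y 0 - z 0| + C / 2 * expR (2 * L * t).
Proof.
move=> t0 L0 C0 cy cz dyE dzE dle.
have cyz : {within `[0, t], continuous (fun s => y s - z s)}.
  by move=> s; apply: cvgB; [exact: cy|exact: cz].
have dyz s : 0 < s < t -> is_derive s 1 (fun s => y s - z s) (dy s - dz s).
  by move=> st; have ? := dyE _ st; have ? := dzE _ st; exact: is_deriveB.
have H : `|(y t - z t) - (y 0 - z 0)| <= C / 2 * expR (2 * L * t).
  exact: norm_derive_le_expR t0 L0 C0 cyz dyz dle.
rewrite -[y t - z t](subrK (y 0 - z 0)) addrC.
by apply: le_trans (ler_normD _ _) _; rewrite lerD2l.
Qed.

Lemma continuous_maxr (c : R) : continuous (fun s => Num.max s c).
Proof.
move=> t; rewrite /continuous_at maxr_absE; under eq_fun do rewrite maxr_absE.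
have cD (u : R) : s + u @[s --> t] --> t + u.
  by apply: cvgD; [exact: cvg_id|exact: cvg_cst].
by apply: cvgMr_tmp; apply: cvgD; [exact: cD|apply: cvg_norm; exact: cD].
Qed.

(** The integral starts at -1 so that 0 is an interior point, where the fundamental theorem of
    calculus still gives continuity. Clipping the argument at 0 freezes the function at negative
    times. *)
Lemma antiderivative (g : R -> R) : continuous g ->
  exists G : R -> R, [/\ continuous G, forall t, t <= 0 -> G t = 0 &
    forall t : R, 0 < t -> is_derive t 1 G (g t)].
Proof.
move=> cg.
pose H t := \int[lebesgue_measure]_(s in `[-1, t]) g s.
have gint (b : R) : lebesgue_measure.-integrable `[-1, b] (EFin \o g).
  apply: continuous_compact_integrable; first exact: segment_compact.
  exact: continuous_subspaceT.
have dH (t : R) : -1 < t -> is_derive t 1 H (g t).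
  move=> t1; have tt : t < t + 1 by rewrite ltrDl.
  have [dHt Ht] := continuous_FTC1_closed tt (gint _) t1 (cg t).
  by split=> //; rewrite -derive1E.
exists (fun t => H (Num.max t 0) - H 0); split.
- move=> t; apply: cvgB; last exact: cvg_cst.
  have cM : Num.max s 0 @[s --> t] --> Num.max t 0.
    exact: continuous_maxr.
  apply: (@cvg_comp _ _ _ (fun s => Num.max s 0) H _ _ _ cM).
  apply/differentiable_continuous/derivable1_diffP.
  have /dH[] // : -1 < Num.max t 0 by rewrite lt_max; lra.
- by move=> t t0; rewrite max_r // subrr.
- move=> t t0.
  have ? := dH t (lt_trans (ltrN10 _) t0).
  apply: (@near_eq_is_derive _ _ _ (fun s => H s - H 0)).
  - near=> s; rewrite max_l //; near: s.
    by have := lt_nbhsr t0; apply: filterS => s; exact: ltW.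
  - by rewrite -[g t]subr0; apply: is_deriveB.
Unshelve. all: by end_near. Qed.

Lemma antiderivative_cV n (g : R -> 'cV[R]_n) : continuous g ->
  exists G : R -> 'cV[R]_n, [/\ continuous G, forall t, t <= 0 -> G t = 0 &
    forall t : R, 0 < t -> is_derive t 1 G (g t)].
Proof.
move=> cg.
have cgi i : continuous (fun t => g t i 0).
  move=> t; apply: (@cvg_comp _ _ _ g (fun v => v i 0) _ _ _ (cg t)).
  exact: coord_continuous.
have [G GP] := choice (fun i => antiderivative (cgi i)).
exists (fun t => \col_i G i t); split.
- move=> t; apply: cvg_cV => i; under eq_fun do rewrite mxE; rewrite mxE.
  by have [cG _ _] := GP i; exact: cG.
- by move=> t t0; apply/colP => i; rewrite !mxE; have [_ ->] := GP i.
- move=> t t0; apply/is_derive_cV => i; under eq_fun do rewrite mxE.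
  by have [_ _] := GP i; exact.
Qed.

End Calculus.

(** * Global solutions of a globally Lipschitz equation *)

Section Picard.
Context {R : realType}.

Lemma exists_div_expn_le (b e : R) : 0 < e -> exists k, b / 2 ^+ k <= e.
Proof.
move=> e0; exists (Num.trunc `|b / e|).+1.
rewrite ler_pdivrMr ?exprn_gt0 // mulrC -ler_pdivrMr //.
apply: (le_trans (ler_norm _)); apply: ltW.
apply: (lt_le_trans (truncnS_gt _)).
by rewrite -natrX ler_nat ltnW // ltn_expl.
Qed.

(** The increments are dominated by a geometric series, so the sequence is Cauchy. The explicit rate
    matters: applied at each time separately, it still yields bounds uniform on bounded time
    intervals. *)
Lemma geometric_limit n (u : nat -> 'cV[R]_n) (a : R) :
  (forall k, `|u k.+1 - u k| <= a / 2 ^+ k) ->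
  exists l, forall k, `|l - u k| <= 2 * a / 2 ^+ k.
Proof.
move=> ua; have a0 : 0 <= a.
  by have := le_trans (normr_ge0 _) (ua 0%N); rewrite expr0 divr1.
(* The right-hand side is the partial sum of the geometric series in telescoped form, which makes
   the induction close. *)
have uk k j : `|u (k + j)%N - u k| <= 2 * a / 2 ^+ k - 2 * a / 2 ^+ (k + j).
  elim: j => [|j ih]; first by rewrite addn0 !subrr normr0.
  rewrite addnS -[u _ - u k](subrKA (u (k + j)%N)).
  apply: (le_trans (ler_normD _ _)).
  have -> : 2 * a / 2 ^+ k - 2 * a / 2 ^+ (k + j).+1 =
      a / 2 ^+ (k + j) + (2 * a / 2 ^+ k - 2 * a / 2 ^+ (k + j)).
    by rewrite exprS; field; rewrite !expf_neq0.
  by rewrite lerD.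
have ub k i : (k <= i)%N -> `|u i - u k| <= 2 * a / 2 ^+ k.
  move=> /subnKC <-; apply: le_trans (uk _ _) _.
  by rewrite gerBl divr_ge0 ?mulr_ge0 // exprn_ge0.
have : cauchy (u @ \oo).
  apply/cauchy_ballP => e e0; rewrite near_simpl.
  have [k ke] := exists_div_expn_le (2 * a) (divr_gt0 e0 (ltr0Sn R 2)).
  exists ([set i | (k <= i)%N], [set i | (k <= i)%N]).
    by split; exists k.
  move=> -[i j] /= [ki kj]; rewrite -ball_normE /=.
  rewrite -(subrKA (u k)) (le_lt_trans (ler_normD _ _)) //.
  rewrite [`|u k - _|]distrC.
  have := ub _ _ ki; have := ub _ _ kj; lra.
move/cauchy_cvgP => ul; exists (lim (u @ \oo)) => k.
apply/ler_addgt0Pl => e e0.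
have [N _ /(_ (maxn N k)) uN] := (cvgrPdist_le _ _).1 ul _ e0.
rewrite -(subrKA (u (maxn N k))) (le_trans (ler_normD _ _)) // lerD //.
  by apply: uN; exact: leq_maxl.
by apply: ub; exact: leq_maxr.
Qed.

Variables (n : nat) (F : 'cV[R]_n -> 'cV[R]_n) (L : R).
Hypotheses (L0 : 0 < L) (FL : forall a b, `|F a - F b| <= L * `|a - b|).

Lemma picard_lindelof (x0 : 'cV[R]_n) :
  exists x : R -> 'cV[R]_n, [/\ continuous x, x 0 = x0 &
    forall t : R, 0 < t -> is_derive t 1 x (F (x t))].
Proof.
have cF : continuous F by exact: lipschitz1_continuous FL.
(* Picard's operator has to be total to be extracted by [choice]; a discontinuous [y] gets a junk
   value, and the iterates never leave the continuous functions. *)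
have ex (y : R -> 'cV[R]_n) : exists z : R -> 'cV[R]_n, continuous y ->
    [/\ continuous z, forall t, t <= 0 -> z t = x0 &
        forall t : R, 0 < t -> is_derive t 1 z (F (y t))].
  have [cy|ncy] := pselect (continuous y); last by exists y.
  have cFy : continuous (fun t => F (y t)).
    by move=> t; exact: (@cvg_comp _ _ _ y F _ _ _ (cy t) (cF _)).
  have [G [cG G0 dG]] := antiderivative_cV cFy.
  exists (fun t => x0 + G t) => _; split.
  - by move=> t; apply: cvgD; [exact: cvg_cst|exact: cG].
  - by move=> t /G0 ->; rewrite addr0.
  - move=> t /dG dGt; rewrite -[F _]add0r; apply: is_deriveD.
have [Phi PhiP] := choice ex.
pose X k := iter k Phi (fun=> x0).
have cX k : continuous (X k).
  by elim: k => [|k /PhiP[]//]; exact: cst_continuous.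
have dX k := PhiP _ (cX k).
have X0 k t : t <= 0 -> X k t = x0.
  by case: k => // k; have [_ z _] := dX k; exact: z.
(* [L * C] is the speed [|F x0|] of the first iterate, which makes the base case of the contraction
   estimate an instance of the weighted bound. *)
pose C := `|F x0| / L; have C0 : 0 <= C by rewrite divr_ge0 // ltW.
pose E t := expR (2 * L * t).
have E1 t : 0 <= t -> 1 <= E t.
  by move=> t0; rewrite -expR0 ler_expR !mulr_ge0 // ltW.
have Xk k t : `|X k.+1 t - X k t| <= C * E t / 2 ^+ k.
  have pos : 0 <= C * E t / 2 ^+ k.
    by rewrite divr_ge0 ?exprn_ge0 // mulr_ge0 ?expR_ge0.
  have [t0|t0] := ltP 0 t; last first.
    by rewrite !X0 // subrr normr0.
  move/ltW in t0.
  elim: k t t0 pos => [|k ih] t t0 pos.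
    have [c1 z1 d1] := dX 0%N; rewrite expr0 divr1.
    apply: (@le_trans _ _ (C / 2 * E t)); last first.
      by rewrite ler_wpM2r ?expR_ge0 //; lra.
    have := @dist_derive_le_expR _ _ (X 1%N) (X 0%N) (fun=> F x0) (fun=> 0)
      C L t t0 L0 C0.
    rewrite !(X0 _ 0) // subrr normr0 add0r; apply.
    - exact: continuous_subspaceT.
    - exact: continuous_subspaceT.
    - by move=> s /andP[/d1].
    - move=> s /andP[/ltW s0 _].
      rewrite subr0 mulrA [L * C]mulrC divfK ?gt_eqF //.
      by rewrite ler_peMr // E1.
  have [c1 z1 d1] := dX k.+1; have [c0 z0 d0] := dX k.
  have Ck : 0 <= C / 2 ^+ k by rewrite divr_ge0 // exprn_ge0.
  have -> : C * E t / 2 ^+ k.+1 = C / 2 ^+ k / 2 * E t.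
    by rewrite exprS; field; rewrite expf_neq0.
  have := @dist_derive_le_expR _ _ (X k.+2) (X k.+1) (fun s => F (X k.+1 s))
    (fun s => F (X k s)) _ _ _ t0 L0 Ck.
  rewrite !(X0 _ 0) // subrr normr0 add0r; apply.
  - exact: continuous_subspaceT.
  - exact: continuous_subspaceT.
  - by move=> s /andP[/d1].
  - by move=> s /andP[/d0].
  - move=> s /andP[/ltW s0 _].
    apply: (le_trans (FL _ _)); rewrite ler_wpM2l ?(ltW L0) //.
    rewrite mulrAC; apply: ih => //.
    by rewrite divr_ge0 ?exprn_ge0 // mulr_ge0 ?expR_ge0.
have [x xP] := choice (fun t => @geometric_limit _ (X ^~ t) _ (Xk ^~ t)).
have EC t : 0 <= 2 * (C * E t) by rewrite mulr_ge0 // mulr_ge0 // expR_ge0.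
have cx : continuous x.
  move=> t; apply/(@cvgrPdist_le _ _ _ _ (nbhs_filter t)) => e e0.
  have e3 : 0 < e / 3 by rewrite divr_gt0.
  (* The error bound increases with time, so taking it at [t + 1] makes it uniform over all times
     near [t]; continuity of the limit follows by splitting [e] in three. *)
  have [k ke] := exists_div_expn_le (2 * (C * E (t + 1))) e3.
  near=> s.
  have xs u : u <= t + 1 -> `|x u - X k u| <= e / 3.
    move=> ut; apply: le_trans (xP _ _) (le_trans _ ke).
    rewrite ler_wpM2r ?invr_ge0 ?exprn_ge0 // ler_wpM2l // ler_wpM2l //.
    by rewrite ler_expR ler_wpM2l // mulr_ge0 // ltW.
  have -> : x t - x s = (x t - X k t) + (X k t - X k s) + (X k s - x s).
    by rewrite !addrA !subrK.
  have -> : e = e / 3 + e / 3 + e / 3 by field.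
  apply: (le_trans (ler_normD _ _)); rewrite lerD //; last first.
    rewrite distrC; apply: xs; near: s.
    have t1 : t < t + 1 by rewrite ltrDl.
    by have := lt_nbhsl t1; apply: filterS => s /ltW.
  apply: (le_trans (ler_normD _ _)); rewrite lerD //.
    by apply: xs; rewrite lerDl.
  near: s; exact: ((@cvgrPdist_le _ _ _ _ (nbhs_filter t) _ _).1 (cX k t)).
have [cy y0 dy] := PhiP _ cx.
(* Both sides are limits of the iterates: [Phi x] is compared with [X k.+1] by one more contraction
   step, and [X k.+1] with [x] by the rate of convergence. *)
have yx t : Phi x t = x t.
  have [t0|t0] := ltP 0 t; last first.
    rewrite y0 //; apply/eqP; rewrite -subr_eq0 -normr_le0 distrC.
    apply/ler_addgt0Pr => e e0; rewrite add0r.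
    have [k ke] := exists_div_expn_le (2 * (C * E t)) e0.
    apply: le_trans ke; have := xP t k.+1.
    rewrite X0 // => /le_trans; apply.
    by rewrite ler_wpM2l // lef_pV2 ?posrE ?exprn_gt0 // ler_eXn2l // ltr1n.
  apply/eqP; rewrite -subr_eq0 -normr_le0.
  apply/ler_addgt0Pr => e e0; rewrite add0r.
  have e2 : 0 < e / 2 by rewrite divr_gt0.
  have [k ke] := exists_div_expn_le (2 * (C * E t)) e2.
  have [c1 z1 d1] := dX k.
  have Ck : 0 <= 2 * C / 2 ^+ k by rewrite divr_ge0 ?exprn_ge0 // mulr_ge0.
  have := @dist_derive_le_expR _ _ (Phi x) (X k.+1) (fun s => F (x s))
    (fun s => F (X k s)) _ _ _ (ltW t0) L0 Ck.
  rewrite (X0 _ 0) // [Phi x 0]y0 // subrr normr0 add0r => H.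
  rewrite -(subrKA (X k.+1 t)) (le_trans (ler_normD _ _)) //.
  have -> : e = e / 2 + e / 2 by field.
  rewrite lerD //.
    apply: le_trans (H _ _ _ _ _) _ => [||s /andP[/dy]|s /andP[/d1]|s _|] //.
    - exact: continuous_subspaceT.
    - exact: continuous_subspaceT.
    - apply: (le_trans (FL _ _)); rewrite ler_wpM2l ?(ltW L0) //.
      by apply: le_trans (xP _ _) _; rewrite mulrA mulrAC.
    apply: le_trans ke.
    have -> : 2 * C / 2 ^+ k / 2 * expR (2 * L * t) = 2 * (C * E t) / 2 ^+ k / 2.
      by rewrite /E; field; rewrite expf_neq0.
    by rewrite ler_pdivrMr // ler_peMr ?ler1n // divr_ge0 // exprn_ge0.
  rewrite distrC; apply: le_trans (xP _ _) (le_trans _ ke).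
  by rewrite ler_wpM2l // lef_pV2 ?posrE ?exprn_gt0 // ler_eXn2l // ltr1n.
exists x; split=> //; first by rewrite -yx y0.
by move=> t /dy; have -> : Phi x = x by apply/funext.
Unshelve. all: by end_near. Qed.

End Picard.

(** * Classical solutions and their dependence on the initial state *)

Section Solutions.
Context {R : realType} {n : nat}.
Implicit Types (F : 'cV[R]_n -> 'cV[R]_n) (x y : R -> 'cV[R]_n).

Definition horizon (T : \bar R) : set R := [set t | 0 <= t /\ (t%:E < T)%E].

(** The derivative is two-sided, hence required at positive times only: values at negative times are
    arbitrary, and the initial instant is covered by continuity within the horizon. *)
Definition solution F (T : \bar R) x : Prop :=
  {within horizon T, continuous x} /\
  forall t : R, 0 < t -> (t%:E < T)%E -> is_derive t 1 x (F (x t)).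

Lemma segment_horizon (T : \bar R) (t : R) :
  (t%:E < T)%E -> `[0, t] `<=` horizon T.
Proof.
move=> tT s /=; rewrite in_itv /= => /andP[s0 st]; split=> //.
by apply: le_lt_trans tT; rewrite lee_fin.
Qed.

Lemma within_continuous_comp (U V : topologicalType) (A : set R)
    (f : R -> U) (g : U -> V) :
  continuous g -> {within A, continuous f} -> {within A, continuous (g \o f)}.
Proof.
by move=> cg cf s; apply: (@cvg_comp _ _ _ f g _ (nbhs (f s)) _ (cf s)); exact: cg.
Qed.

(** Let [M] be the maximum on [[0, t]] of the distance weighted by [expR (- (2 L s))], attained at
    [c]. The derivative estimate bounds the distance at [c] by the initial distance plus half of
    itself; absorbing that half gives the factor 2. *)
Lemma dist_solution_le F (L : R) x y (t : R) :
  0 < L -> (forall a b, `|F a - F b| <= L * `|a - b|) ->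
  solution F +oo%E x -> solution F +oo%E y -> 0 <= t ->
  `|x t - y t| <= 2 * `|x 0 - y 0| * expR (2 * L * t).
Proof.
move=> L0 FL [cx dx] [cy dy] t0.
have c0t (z : R -> 'cV[R]_n) : {within horizon +oo%E, continuous z} ->
    forall s : R, {within `[0, s], continuous z}.
  by move=> cz s; exact: (continuous_subspaceW (segment_horizon (ltry s)) cz).
pose phi s := `|x s - y s| * expR (- (2 * L * s)).
have cphi : {within `[0, t], continuous phi}.
  move=> s; apply: cvgM.
    by apply: cvg_norm; apply: cvgB; [exact: (c0t _ cx)|exact: (c0t _ cy)].
  have : continuous (fun s => expR (- (2 * L * s))).
    move=> u; apply: (@cvg_comp _ _ _ (fun s => - (2 * L * s)) expR _ _ _ _
      (@continuous_expR R _)).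
    by apply: cvgN; apply: cvgMl_tmp; exact: cvg_id.
  by move=> ce; exact: (continuous_subspaceT ce).
have [c] := EVT_max t0 cphi; rewrite in_itv /= => /andP[c0 ct] phic.
set M := phi c in phic; have M0 : 0 <= M by rewrite mulr_ge0 // expR_ge0.
have bound s : 0 <= s <= t -> `|x s - y s| <= M * expR (2 * L * s).
  move=> st; have := phic s; rewrite in_itv /= => /(_ st).
  by rewrite /phi expRN ler_pdivrMr ?expR_gt0.
have refined s : 0 <= s <= t ->
    `|x s - y s| <= `|x 0 - y 0| + M / 2 * expR (2 * L * s).
  move=> /andP[s0 st].
  apply: (@dist_derive_le_expR _ _ x y (fun r => F (x r)) (fun r => F (y r))) => //.
  - exact: c0t.
  - exact: c0t.
  - by move=> r /andP[r0 _]; apply: dx; rewrite ?ltry.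
  - by move=> r /andP[r0 _]; apply: dy; rewrite ?ltry.
  - move=> r /andP[/ltW r0 rs]; apply: (le_trans (FL _ _)).
    rewrite ler_wpM2l ?(ltW L0) // bound // r0 /=.
    by rewrite (le_trans (ltW rs)).
have Mle : M <= 2 * `|x 0 - y 0|.
  have := refined c; rewrite c0 ct => /(_ isT).
  have -> : `|x c - y c| = M * expR (2 * L * c).
    by rewrite /M /phi -mulrA -expRD addNr expR0 mulr1.
  have e1 : 1 <= expR (2 * L * c).
    by rewrite -expR0 ler_expR mulr_ge0 // mulr_ge0 // ltW.
  have : M <= M * expR (2 * L * c) by rewrite ler_peMr.
  lra.
apply: (le_trans (bound t _)); first by rewrite t0 lexx.
by rewrite ler_wpM2r ?expR_ge0.
Qed.

Lemma solution_shift F x (s : R) : 0 <= s ->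
  solution F +oo%E x -> solution F +oo%E (fun t => x (s + t)).
Proof.
move=> s0 [cx dx]; split.
  apply/subspace_continuousP => t [t0 _] U xU.
  have xst : x @ within (horizon +oo%E) (nbhs (s + t)) --> x (s + t).
    by apply: ((subspace_continuousP _ _).1 cx); split; rewrite ?addr_ge0 ?ltry.
  have st : s + r @[r --> t] --> s + t.
    by apply: cvgD; [exact: cvg_cst|exact: cvg_id].
  have := st _ (xst _ xU); rewrite /within /= !near_simpl.
  apply: filterS => r /= rU [r0 _]; apply: rU; split; last exact: ltry.
  by rewrite addr_ge0.
move=> t t0 _; apply/is_derive_cV => i.
have dxs : is_derive (s + t) 1 (fun r => x r i 0) (F (x (s + t)) i 0).
  suff /is_derive_cV : is_derive (s + t) 1 x (F (x (s + t))) by exact.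
  by apply: dx; rewrite ?ltry // ltr_wpDl.
have dst : is_derive t 1 (fun r => s + r) 1.
  by rewrite -[X in is_derive _ _ _ X]add0r; exact: is_deriveD.
by have := is_derive1_comp dxs dst; rewrite mulr1.
Qed.

End Solutions.

(** * Integral trajectories under a constant input are classical solutions *)

Section Trajectories.
Context {R : realType} {n m p : nat}.
Variables (Sg : system R n m p) (v : 'cV[R]_m).
Hypothesis rate_cont : continuous (fun x => rate Sg x v).

(** With a constant input the integrand is continuous along a continuous curve, so the two
    directions are the two fundamental theorems of calculus. *)
Lemma trajectory_solution T x :
  trajectory Sg T (fun=> v) x <-> solution (fun x => rate Sg x v) T x.
Proof.
have cr (A : set R) (y : R -> 'cV[R]_n) : {within A, continuous y} -> forall i,
    {within A, continuous (fun s => rate Sg (y s) v i 0)}.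
  move=> cy i.
  apply: (@within_continuous_coord _ _ A (fun s => rate Sg (y s) v)).
  exact: (within_continuous_comp rate_cont cy).
split=> [[cx xE]|[cx dx]]; split=> // t.
  move=> t0 tT; apply/is_derive_cV => i.
  (* Differentiating the integral at [t] needs an interval in which [t] is interior, hence a later
     time still inside the horizon. *)
  have [u tu uT] : exists2 u, t < u & (u%:E < T)%E.
    move: tT; case: (T) => [r|_|] //; last by exists (t + 1); rewrite ?ltrDl ?ltry.
    rewrite lte_fin => tr; exists ((t + r) / 2); rewrite ?lte_fin; lra.
  have u0 := lt_trans t0 tu.
  have [fi _] := xE u i (ltW u0) uT.
  have cf : {within `[0, u], continuous (fun s => rate Sg (x s) v i 0)}.
    by apply: cr; exact: (continuous_subspaceW (segment_horizon uT) cx).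
  have ct : {for t, continuous (fun s => rate Sg (x s) v i 0)}.
    have [+ _ _] := (continuous_within_itvP _ u0).1 cf; apply.
    by rewrite in_itv /= t0.
  have [dI IE] := continuous_FTC1_closed tu fi t0 ct.
  pose I s := \int[lebesgue_measure]_(r in `[0, s]) rate Sg (x r) v i 0.
  apply: (@near_eq_is_derive _ _ _ (fun s => x 0 i 0 + I s)).
    near=> s; have [] := xE s i _ _ => //.
    - by apply: ltW; near: s; exact: lt_nbhsr.
    - apply: lt_trans uT; rewrite lte_fin; near: s; exact: lt_nbhsl.
  have dI' : is_derive t 1 I (rate Sg (x t) v i 0).
    by split=> //; rewrite -derive1E.
  by rewrite -[X in is_derive _ _ _ X]add0r; exact: is_deriveD.
move=> i; rewrite le_eqVlt => /predU1P[<-|t0] tT.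
  rewrite set_itv1 Rintegral_set1 addr0; split=> //.
  apply: continuous_compact_integrable; first exact: compact_set1.
  exact: continuous_subspace1.
have cxt : {within `[0, t], continuous x}.
  exact: (continuous_subspaceW (segment_horizon tT) cx).
split.
  apply: continuous_compact_integrable; first exact: segment_compact.
  exact: cr.
have := @continuous_FTC2 R (fun s => rate Sg (x s) v i 0) (fun s => x s i 0) 0 t t0.
have dxi s : s \in `]0, t[ -> is_derive s 1 (fun s => x s i 0) (rate Sg (x s) v i 0).
  rewrite in_itv /= => /andP[s0 st].
  suff /is_derive_cV : is_derive s 1 x (rate Sg (x s) v) by exact.
  by apply: dx => //; apply: lt_trans tT; rewrite lte_fin.
have [_ x0 xt] := (continuous_within_itvP _ t0).1 
  (@within_continuous_coord _ _ _ x i cxt).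
rewrite /Rintegral => ->; first by rewrite /= subrKC.
- exact: cr.
- by split=> // s /dxi[].
- by move=> s /dxi ?; rewrite derive1E derive_val.
Unshelve. all: by end_near. Qed.

End Trajectories.

(** * Local Lipschitz continuity, compact sets and cutoffs *)

Section LocallyLipschitz.
Context {R : realType}.

Lemma locally_lipschitzP n k (F : 'cV[R]_n -> 'cV[R]_k) :
  locally_lipschitz F <-> forall x, exists L r : R, [/\ 0 <= L, 0 < r &
    forall y z, `|x - y| < r -> `|x - z| < r -> `|F y - F z| <= L * `|y - z|].
Proof.
split=> FL x.
  have [U /nbhs_ballP[r /= r0 rU] [M [_ UM]]] := FL x.
  exists (`|M| + 1), r; split=> // y z xy xz.
  apply: (UM (`|M| + 1) _ (y, z)) => /=.
    by rewrite (le_lt_trans (ler_norm _)) // ltrDl.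
  by split; apply: rU; rewrite -ball_normE.
have [L [r [L0 r0 FLr]]] := FL x.
exists (ball x r); first exact: nbhsx_ballx.
exists L; split; first exact: num_real.
move=> M LM [y z] /= [xy xz].
move: xy xz; rewrite -!ball_normE /= => xy xz.
by apply: le_trans (FLr _ _ xy xz) _; rewrite ler_wpM2r // ltW.
Qed.

Lemma locally_lipschitz_continuous n k (F : 'cV[R]_n -> 'cV[R]_k) :
  locally_lipschitz F -> continuous F.
Proof.
move=> /locally_lipschitzP FL x; have [L [r [L0 r0 FLr]]] := FL x.
apply/(@cvgrPdist_le _ _ _ _ (nbhs_filter x)) => e e0.
pose d := Num.min (r / 2) (e / (L + 1)).
have d0 : 0 < d by rewrite lt_min !divr_gt0 // ltr_wpDl.
have := near_norm_le x d0; apply: filterS => y.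
rewrite le_min => /andP[xr xe].
apply: (le_trans (FLr _ _ _ _)); first by rewrite subrr normr0.
  by apply: le_lt_trans xr _; lra.
apply: (@le_trans _ _ ((L + 1) * `|x - y|)); first by rewrite ler_wpM2r // lerDl.
by rewrite mulrC -ler_pdivlMr // ltr_wpDl.
Qed.

(** The product [K * K] is covered by two kinds of neighbourhoods. At a diagonal point the local
    constant serves; at a pair of distinct points the two arguments stay apart while their images
    stay bounded, which bounds the difference quotient. *)
Lemma locally_lipschitz_compact n k (F : 'cV[R]_n -> 'cV[R]_k) (K : set 'cV[R]_n) :
  locally_lipschitz F -> compact K ->
  exists2 L, 0 < L & forall y z, K y -> K z -> `|F y - F z| <= L * `|y - z|.
Proof.
move=> LF cK; have /locally_lipschitzP FL := LF.
have cF := locally_lipschitz_continuous LF.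
have /compact_near_coveringP cKK := compact_setX cK cK.
have [] := cKK R +oo (fun L yz => `|F yz.1 - F yz.2| <= L * `|yz.1 - yz.2|) _.
  move=> [y z] /= _; have [<-|yz] := eqVneq y z.
    have [L [r [L0 r0 FLr]]] := FL y.
    exists (ball y r `*` ball y r, [set M | L < M]); first split => /=.
    - by exists (ball y r, ball y r) => //; split; exact: nbhsx_ballx.
    - by exists L; split=> //; exact: num_real.
    move=> [[y' z'] M] /= [[]]; rewrite -!ball_normE /= => yy yz LM.
    by apply: le_trans (FLr _ _ yy yz) _; rewrite ler_wpM2r // ltW.
  (* Moving each point by at most [d] leaves a distance of at least [4 d - 2 d], the denominator of
     [C] below. *)
  pose d := `|y - z| / 4; have d0 : 0 < d by rewrite divr_gt0 // normr_gt0 subr_eq0.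
  have nF w : \forall w' \near w, `|F w - F w'| <= 1.
    by move: (cF w) => /(@cvgrPdist_le _ _ _ _ (nbhs_filter w)); apply.
  pose A w := [set w' | `|w - w'| <= d /\ `|F w - F w'| <= 1].
  have nA w : nbhs w (A w) by exact: filterI (near_norm_le w d0) (nF w).
  pose C := (`|F y - F z| + 2) / (2 * d).
  exists (A y `*` A z, [set M | C < M]); first split => /=.
  - by exists (A y, A z) => //; split; exact: nA.
  - by exists C; split=> //; exact: num_real.
  move=> [[y' z'] M] /= [[[yd y1] [zd z1]] CM].
  have e1 : F y' - F z' = - (F y - F y') + ((F y - F z) + (F z - F z')).
    by rewrite subrKA opprB addrA subrK.
  have e2 : y - z = (y - y') + ((y' - z') - (z - z')).
    by rewrite opprB addrA subrKA subrKA.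
  have H1 : `|F y' - F z'| <= `|F y - F z| + 2.
    rewrite e1 (le_trans (ler_normD _ _)) // normrN.
    have := ler_normD (F y - F z) (F z - F z'); lra.
  have H2 : 2 * d <= `|y' - z'|.
    have e3 : 4 * d = `|y - z| by rewrite /d; field.
    have : `|y - z| <= `|y - y'| + (`|y' - z'| + `|z - z'|).
      by rewrite {1}e2 (le_trans (ler_normD _ _)) // lerD2l ler_normB.
    lra.
  apply: (le_trans H1).
  have -> : `|F y - F z| + 2 = C * (2 * d) by rewrite /C; field; rewrite gt_eqF.
  have C0 : 0 <= C by rewrite divr_ge0 ?addr_ge0 // mulr_ge0 // ltW.
  by rewrite ler_pM // ?mulr_ge0 // ltW.
move=> M [_ MK]; exists (`|M| + 1) => [|y z Ky Kz]; first by rewrite ltr_wpDl.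
apply: (MK (`|M| + 1) _ (y, z)) => //.
by rewrite (le_lt_trans (ler_norm _)) // ltrDl.
Qed.

Lemma compact_norm_le n (x0 : 'cV[R]_n) (r : R) :
  compact [set x | `|x - x0| <= r].
Proof.
apply: compact_cV.
  exists (`|x0| + r); split; first exact: num_real.
  move=> M xM x /= Kx.
  rewrite -(subrK x0 x) (le_trans (ler_normD _ _)) //.
  by move: Kx xM; lra.
suff : closed ((fun x : 'cV[R]_n => `|x - x0|) @^-1` [set y | y <= r]) by [].
apply: preimage_closed; last exact: closed_le.
move=> x _; apply: (@cvg_norm _ _ _ (nbhs x)).
by apply: cvgB; [exact: cvg_id|exact: cvg_cst].
Qed.

(** [chi] equals 1 on the ball of radius [rho] and falls with slope 1 to vanish at distance
    [rho + 1]. The constant [L + M] is a product rule: [L] is a Lipschitz constant and [M] a bound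
    of [F] on the larger ball, where [chi] is 1-Lipschitz with values in [[0, 1]]. *)
Lemma cutoff n (F : 'cV[R]_n -> 'cV[R]_n) (x0 : 'cV[R]_n) (rho : R) :
  locally_lipschitz F -> 0 <= rho ->
  exists (chi : 'cV[R]_n -> R) (L : R), [/\ 0 < L,
    forall x, 0 <= chi x, forall x, `|x - x0| <= rho -> chi x = 1 &
    forall x y, `|chi x *: F x - chi y *: F y| <= L * `|x - y|].
Proof.
move=> FL rho0; pose chi x := Num.max 0 (Num.min 1 (rho + 1 - `|x - x0|)).
pose K := [set x : 'cV[R]_n | `|x - x0| <= rho + 1].
have cK : compact K by exact: compact_norm_le.
have [L L0 FK] := locally_lipschitz_compact FL cK.
pose M := `|F x0| + L * (rho + 1).
have FM x : K x -> `|F x| <= M.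
  move=> Kx; have Kx0 : K x0 by rewrite /K /= subrr normr0; lra.
  rewrite -(subrK (F x0) (F x)) (le_trans (ler_normD _ _)) // addrC lerD2l.
  by apply: le_trans (FK _ _ Kx Kx0) _; rewrite ler_pM2l.
have M0 : 0 <= M by rewrite addr_ge0 // mulr_ge0 ?ltW // ltr_wpDl.
have chi_lip x y : `|chi x - chi y| <= `|x - y|.
  have h1 : `|x - x0| <= `|x - y| + `|y - x0|.
    by rewrite -(subrKA y x) ler_normD.
  have h2 : `|y - x0| <= `|x - y| + `|x - x0|.
    by rewrite -(subrKA x y) (distrC x y) ler_normD.
  have clip (a b e : R) : a - b <= e -> b - a <= e -> 0 <= e ->
      `|Num.max 0 (Num.min 1 a) - Num.max 0 (Num.min 1 b)| <= e.
    move=> ab ba e0; rewrite ler_norml.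
    case: (leP 1 a) => ?; case: (leP 1 b) => ?; rewrite ?(max_r ler01);
      case: (leP 0 a) => ?; case: (leP 0 b) => ?; lra.
  by apply: clip => //; lra.
have chi0 x : 0 <= chi x by rewrite /chi le_max lexx.
have chi1 x : chi x <= 1 by rewrite /chi ge_max ler01 ge_min lexx.
have chiK x : ~ K x -> chi x = 0.
  move=> /negP; rewrite -ltNge => Kx; apply: max_l.
  by rewrite ge_min; apply/orP; right; lra.
exists chi, (L + M); split=> // [|x xr|x y].
- by rewrite ltr_wpDr.
- by rewrite /chi min_l ?max_r //; lra.
have [Kx|Kx] := pselect (K x); last first.
  rewrite [chi x]chiK // scale0r sub0r normrN normrZ.
  have [Ky|Ky] := pselect (K y); last first.
    by rewrite chiK // normr0 mul0r mulr_ge0 // addr_ge0 // ltW.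
  have := chi_lip x y; rewrite [chi x]chiK // sub0r normrN => h.
  rewrite mulrC; apply: ler_pM => //.
  by apply: le_trans (FM _ Ky) _; rewrite lerDr ltW.
have [Ky|Ky] := pselect (K y); last first.
  have := chi_lip x y; rewrite [chi y]chiK // subr0 => h.
  rewrite scale0r subr0 normrZ mulrC; apply: ler_pM => //.
  by apply: le_trans (FM _ Kx) _; rewrite lerDr ltW.
have -> : chi x *: F x - chi y *: F y =
    chi x *: (F x - F y) + (chi x - chi y) *: F y.
  by rewrite scalerBr scalerBl addrA subrK.
rewrite mulrDl (le_trans (ler_normD _ _)) // lerD // normrZ.
  rewrite ger0_norm //; apply: le_trans (FK _ _ Kx Ky).
  by rewrite ler_piMl.
by rewrite mulrC; apply: ler_pM => //; exact: FM.
Qed.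

End LocallyLipschitz.

(** * Lyapunov stability, global existence and LaSalle's principle *)

Section Lyapunov.
Context {R : realType} {n : nat}.
Implicit Types (F : 'cV[R]_n -> 'cV[R]_n) (B : 'cV[R]_n -> R).

Lemma le_along_solution F B (T : \bar R) (x : R -> 'cV[R]_n) (t : R) :
  (forall x, differentiable B x) -> (forall x, dotv (grad B x) (F x) <= 0) ->
  solution F T x -> 0 <= t -> (t%:E < T)%E -> B (x t) <= B (x 0).
Proof.
move=> dB decr [cx dx] t0 tT.
apply: (@le0_derive_le _ (B \o x) (fun s => dotv (grad B (x s)) (F (x s)))) => //.
- apply: within_continuous_comp.
    by move=> y; exact: differentiable_continuous.
  exact: (continuous_subspaceW (segment_horizon tT) cx).
- move=> s /andP[s0 st]; apply: is_derive_grad => //; apply: dx => //.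
  by apply: lt_trans tT; rewrite lte_fin.
Qed.

Lemma solution_eq F1 F2 (T : \bar R) (x : R -> 'cV[R]_n) :
  (forall t, 0 < t -> (t%:E < T)%E -> F1 (x t) = F2 (x t)) ->
  solution F1 T x -> solution F2 T x.
Proof.
by move=> FE [cx dx]; split=> // t t0 tT; rewrite -FE //; exact: dx.
Qed.

Variables (F : 'cV[R]_n -> 'cV[R]_n) (B : 'cV[R]_n -> R) (xb : 'cV[R]_n).
Hypotheses (FL : locally_lipschitz F) (dB : forall x, differentiable B x)
  (decr : forall x, dotv (grad B x) (F x) <= 0)
  (B_ge0 : forall x, 0 <= B x) (Bxb : B xb = 0)
  (B_pos : forall r : R, 0 < r -> exists2 beta, 0 < beta &
     forall x, B x < beta -> `|x - xb| < r)
  (B_coercive : forall c : R, exists2 rho, 0 <= rho &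
     forall x, B x <= c -> `|x - xb| <= rho).

Let cB : continuous B.
Proof. by move=> x; exact: differentiable_continuous. Qed.

Lemma lyapunov_stable (e : R) : 0 < e -> exists2 d : R, 0 < d &
  forall (T : \bar R) x, solution F T x -> `|x 0 - xb| < d ->
    forall t : R, 0 <= t -> (t%:E < T)%E -> `|x t - xb| < e.
Proof.
move=> /B_pos[beta beta0 Be].
have : \forall y \near xb, B y < beta.
  have cBxb : B y @[y --> xb] --> B xb by exact: cB.
  move/(@cvgrPdist_lt _ _ _ _ (nbhs_filter xb))/(_ _ beta0): cBxb.
  by apply: filterS => y; rewrite Bxb sub0r normrN; exact/le_lt_trans/ler_norm.
move=> /nbhs_ballP[d /= d0 dB0]; exists d => // T x xsol x0 t t0 tT.
apply: Be; apply: (le_lt_trans (le_along_solution dB decr xsol t0 tT)).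
by apply: dB0; rewrite -ball_normE /= distrC.
Qed.

(* Scaling the vector field by a cutoff only scales the derivative of [B], so
   sublevel sets stay invariant and no continuation argument is needed. *)
Lemma lipschitz_truncation (c : R) : exists (G : 'cV[R]_n -> 'cV[R]_n) (L : R),
  [/\ 0 < L, forall a b, `|G a - G b| <= L * `|a - b|,
      forall x, B x <= c -> G x = F x & forall x, dotv (grad B x) (G x) <= 0].
Proof.
have [rho rho0 Brho] := B_coercive c.
have [chi [L [L0 chi0 chi1 chiL]]] := cutoff xb FL rho0.
exists (fun x => chi x *: F x), L; split=> // x.
  by move=> /Brho /chi1 ->; rewrite scale1r.
by rewrite dotvZr mulr_ge0_le0.
Qed.

(** The truncated field has a global solution; [B] does not increase along it, so it stays in the
    sublevel set of [x0], where the truncation is invisible. *)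
Lemma solution_exists x0 : exists2 x, solution F +oo%E x & x 0 = x0.
Proof.
have [G [L [L0 GL GF decrG]]] := lipschitz_truncation (B x0).
have [x [cx x00 dx]] := picard_lindelof L0 GL x0.
have xG : solution G +oo%E x.
  by split=> [|t t0 _]; [exact: continuous_subspaceT|exact: dx].
exists x => //; apply: (solution_eq _ xG) => t t0 tT; apply: GF.
by rewrite -x00; apply: (le_along_solution _ _ xG) => //; exact: ltW.
Qed.

(** The conclusion is taken at time 1 because the derivative of [B] is controlled at positive times
    only. Nothing is lost: [B] is constant along the solution in question, so its value at time 1
    gives the one at time 0. *)
Hypothesis observable : forall z, solution F +oo%E z ->
  (forall t, 0 < t -> dotv (grad B (z t)) (F (z t)) = 0) -> z 1 = xb.

Lemma lasalle_cvg x : solution F +oo%E x -> x t @[t --> +oo] --> xb.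
Proof.
move=> xF.
have Bx s t : 0 <= s -> s <= t -> B (x t) <= B (x s).
  move=> s0 st.
  have := le_along_solution dB decr (solution_shift s0 xF) (t := t - s) _ (ltry _).
  by rewrite subr_ge0 addr0 subrKC; exact.
pose c := B (x 0).
have Bc t : 0 <= t -> B (x t) <= c by move=> t0; exact: Bx.
have [G [L [L0 GL GF decrG]]] := lipschitz_truncation c.
have xG : solution G +oo%E x.
  by apply: (solution_eq _ xF) => t /ltW t0 _; rewrite GF // Bc.
have [rho rho0 Brho] := B_coercive c.
pose K := [set y : 'cV[R]_n | `|y - xb| <= rho + 1].
have cK : compact K by exact: compact_norm_le.
pose A := [set B (x t) | t in [set t : R | 0 <= t]].
have A0 : has_inf A.
  by split; [exists (B (x 0)), 0; rewrite /= ?lexx|exists 0 => _ [t _ <-]].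
pose b := inf A.
have bB t : 0 <= t -> b <= B (x t).
  by move=> t0; apply: ge_inf; [case: A0|exists t].
have Bb e : 0 < e -> exists2 s, 0 <= s & forall t, s <= t -> B (x t) < b + e.
  move=> e0; have [_ [s s0 <-] sb] := inf_adherent e0 A0.
  by exists s => // t st; apply: le_lt_trans sb; exact: Bx.
have xK : (x @ +oo) K.
  exists 0; split; first exact: num_real.
  by move=> t t0 /=; rewrite /K /= (le_trans (Brho _ (Bc _ (ltW t0)))) // lerDl.
(* Every limit point is [xb]: along the solution started at such a point, [B] keeps the limiting
   value [b], and observability applies. *)
have clx q : cluster (x @ +oo) q -> q = xb.
  move=> clq.
  have Bq : B q <= c.
    rewrite leNgt; apply/negP => cq.
    have nq : nbhs q [set y | c < B y].
      have cBq : B y @[y --> q] --> B q by exact: cB.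
      by have /(_ cq) := @cvgr_gt _ _ _ (nbhs_filter q) _ _ cBq c.
    have [|y [/= ? ]] := clq [set y | B y <= c] _ _ nq; last lra.
    exists 0; split; first exact: num_real.
    by move=> t /ltW; exact: Bc.
  have [z [cz z0 dz]] := picard_lindelof L0 GL q.
  have zG : solution G +oo%E z.
    by split=> [|t t0 _]; [exact: continuous_subspaceT|exact: dz].
  have zF : solution F +oo%E z.
    apply: (solution_eq _ zG) => t t0 tT; apply: GF.
    apply: le_trans Bq; rewrite -z0.
    by apply: (le_along_solution _ _ zG) => //; exact: ltW.
  have Bz s : 0 <= s -> B (z s) = b.
    move=> s0; apply/eqP; rewrite -subr_eq0 -normr_le0.
    apply/ler_addgt0Pr => e e0; rewrite add0r.
    have e2 : 0 < e / 2 by rewrite divr_gt0.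
    have cBz : B y @[y --> z s] --> B (z s) by exact: cB.
    move/(@cvgrPdist_le _ _ _ _ (nbhs_filter (z s)))/(_ _ e2): cBz.
    move=> /nbhs_ballP[d /= d0 dBz].
    (* By the Gronwall estimate, solutions that start less than [r] apart are less than [d] apart
       after time [s]. *)
    pose r := d / (2 * expR (2 * L * s)).
    have r0 : 0 < r by rewrite divr_gt0 // mulr_gt0 // expR_gt0.
    have [t0 t00 Bt] := Bb _ e2.
    have [|_ [[t [tt0 <-]]]] := clq [set x t | t in [set t | t0 <= t]] _ _
      (nbhsx_ballx q r r0).
      exists t0; split; first exact: num_real.
      by move=> t /= /ltW tt0; exists t.
    rewrite -ball_normE /= => qxt.
    have tp : 0 <= t by apply: le_trans tt0.
    have zx : `|z s - x (t + s)| < d.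
      have := dist_solution_le L0 GL zG (solution_shift tp xG) s0.
      rewrite z0 addr0 => /le_lt_trans; apply.
      have -> : d = 2 * r * expR (2 * L * s).
        by rewrite /r; field; rewrite gt_eqF // expR_gt0.
      by rewrite ltr_pM2r ?expR_gt0 // ltr_pM2l.
    have := dBz (x (t + s)); rewrite -ball_normE /= => /(_ zx).
    have := Bt (t + s); rewrite (le_trans tt0) ?lerDl // => /(_ isT).
    have := bB (t + s); rewrite addr_ge0 // => /(_ isT).
    by rewrite !ler_norml; lra.
  have z1 : z 1 = xb.
    apply: observable => // t t0.
    have dzt : is_derive t 1 (B \o z) (dotv (grad B (z t)) (F (z t))).
      by apply: is_derive_grad => //; case: zF => _; apply; rewrite ?ltry.
    have db : is_derive t 1 (B \o z) 0.
      apply: (@near_eq_is_derive _ _ _ (cst b)).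
      have := lt_nbhsr t0; apply: filterS => s /ltW s0 /=; exact/esym/Bz.
    by rewrite -(@derive_val _ _ _ _ _ _ _ dzt) (@derive_val _ _ _ _ _ _ _ db).
  have Bq0 : B q = 0 by rewrite -z0 Bz // -(Bz 1) // z1.
  apply/eqP; rewrite -subr_eq0 -normr_le0; apply/ler_addgt0Pr => e e0.
  by have [beta beta0 Be] := B_pos e0; rewrite add0r ltW // Be // Bq0.
have nK : nbhs xb K.
  by have := near_norm_le xb (ltr_wpDl rho0 ltr01); apply: filterS => y; rewrite distrC.
(* A curve that eventually stays in a compact set and has a single cluster point converges to it. *)
apply: (@compact_cluster_set1 _ xb _ K _ cK nK _ xK); first exact: norm_hausdorff.
apply/seteqP; split=> [q /clx -> //|_ ->].
have [q [_ clq]] := cK _ _ xK.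
by rewrite -(clx _ clq).
Qed.

End Lyapunov.

(** * Closure properties of local Lipschitz continuity *)

Section LipschitzClosure.
Context {R : realType}.

Lemma locally_lipschitz_cst n k (c : 'cV[R]_k) :
  locally_lipschitz (fun _ : 'cV[R]_n => c).
Proof.
apply/locally_lipschitzP => x; exists 0, 1; split=> // y z _ _.
by rewrite subrr normr0 mul0r.
Qed.

Lemma locally_lipschitzD n k (F G : 'cV[R]_n -> 'cV[R]_k) :
  locally_lipschitz F -> locally_lipschitz G ->
  locally_lipschitz (fun x => F x + G x).
Proof.
move=> /locally_lipschitzP FL /locally_lipschitzP GL; apply/locally_lipschitzP => x.
have [L [r [L0 r0 FLr]]] := FL x; have [M [s [M0 s0 GMs]]] := GL x.
exists (L + M), (Num.min r s); split=> [||y z]; first exact: addr_ge0.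
  by rewrite lt_min r0.
rewrite !lt_min => /andP[yr ys] /andP[zr zs].
rewrite opprD addrACA mulrDl (le_trans (ler_normD _ _)) // lerD //.
- exact: FLr.
- exact: GMs.
Qed.

Lemma locally_lipschitz_mulmx n k l (A : 'M[R]_(l, k)) (F : 'cV[R]_n -> 'cV[R]_k) :
  locally_lipschitz F -> locally_lipschitz (fun x => A *m F x).
Proof.
move=> /locally_lipschitzP FL; apply/locally_lipschitzP => x.
have [L [r [L0 r0 FLr]]] := FL x; have [C C0 AC] := norm_mulmx_le A.
exists (C * L), r; split=> // [|y z xy xz]; first exact: mulr_ge0.
rewrite -mulmxBr -mulrA (le_trans (AC _)) // ler_wpM2l //; exact: FLr.
Qed.

Lemma locally_lipschitzB n k (F G : 'cV[R]_n -> 'cV[R]_k) :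
  locally_lipschitz F -> locally_lipschitz G ->
  locally_lipschitz (fun x => F x - G x).
Proof.
move=> FL GL; apply: locally_lipschitzD => //.
have := locally_lipschitz_mulmx (- 1%:M) GL.
by under eq_fun do rewrite mulNmx mul1mx.
Qed.

Lemma locally_lipschitz_usubmx n1 n2 k (F : 'cV[R]_n1 -> 'cV[R]_k) :
  locally_lipschitz F ->
  locally_lipschitz (fun x : 'cV[R]_(n1 + n2) => F (usubmx x)).
Proof.
move=> /locally_lipschitzP FL; apply/locally_lipschitzP => x.
have [L [r [L0 r0 FLr]]] := FL (usubmx x).
have sub (a b : 'cV[R]_(n1 + n2)) : `|usubmx a - usubmx b| <= `|a - b|.
  by rewrite -linearB norm_usubmx_le.
exists L, r; split=> // y z xy xz.
apply: le_trans (FLr _ _ _ _) _; try exact: le_lt_trans (sub _ _) _.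
by rewrite ler_wpM2l.
Qed.

Lemma locally_lipschitz_dsubmx n1 n2 k (F : 'cV[R]_n2 -> 'cV[R]_k) :
  locally_lipschitz F ->
  locally_lipschitz (fun x : 'cV[R]_(n1 + n2) => F (dsubmx x)).
Proof.
move=> /locally_lipschitzP FL; apply/locally_lipschitzP => x.
have [L [r [L0 r0 FLr]]] := FL (dsubmx x).
have sub (a b : 'cV[R]_(n1 + n2)) : `|dsubmx a - dsubmx b| <= `|a - b|.
  by rewrite -linearB norm_dsubmx_le.
exists L, r; split=> // y z xy xz.
apply: le_trans (FLr _ _ _ _) _; try exact: le_lt_trans (sub _ _) _.
by rewrite ler_wpM2l.
Qed.

Lemma locally_lipschitz_col_mx n k l (F : 'cV[R]_n -> 'cV[R]_k)
    (G : 'cV[R]_n -> 'cV[R]_l) :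
  locally_lipschitz F -> locally_lipschitz G ->
  locally_lipschitz (fun x => col_mx (F x) (G x)).
Proof.
move=> /locally_lipschitzP FL /locally_lipschitzP GL; apply/locally_lipschitzP => x.
have [L [r [L0 r0 FLr]]] := FL x; have [M [s [M0 s0 GMs]]] := GL x.
exists (L + M), (Num.min r s); split=> [||y z]; first exact: addr_ge0.
  by rewrite lt_min r0.
rewrite !lt_min => /andP[yr ys] /andP[zr zs].
rewrite opp_col_mx add_col_mx; apply: norm_col_mx_le.
  by apply: le_trans (FLr _ _ yr zr) _; rewrite ler_wpM2r // lerDl.
by apply: le_trans (GMs _ _ ys zs) _; rewrite ler_wpM2r // lerDr.
Qed.

End LipschitzClosure.

(** * Further rules for the inner product *)

Section Dotv.
Context {R : realType}.

Lemma dotv_ge0 n (a : 'cV[R]_n) : 0 <= dotv a a.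
Proof.
by rewrite /dotv mxE; apply: sumr_ge0 => i _; rewrite mxE -expr2 sqr_ge0.
Qed.

Lemma dotvBr n (a b c : 'cV[R]_n) : dotv a (b - c) = dotv a b - dotv a c.
Proof. by rewrite dotvDr dotvNr. Qed.

Lemma dotvZl n k (a b : 'cV[R]_n) : dotv (k *: b) a = k * dotv b a.
Proof. by rewrite dotvC dotvZr dotvC. Qed.

End Dotv.

(** * From the Hill-Moylan identities to dissipation *)

Section HillMoylan.
Context {R : realType} {n m p : nat}.
Variables (Sg : system R n m p) (w : supply R m p) (V : 'cV[R]_n -> R).
Hypotheses (rG : \rank (sys_G Sg) = m) (ws : supply_symmetric w)
  (HM : EID_Hill_Moylan Sg V w).

(* Completing the square: the two sides differ by [|l + W (u - ub)|^2]. *)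
Lemma Hill_Moylan_dissipation xb : equilibria Sg xb -> forall x u,
  dotv (grad V x - grad V xb) (rate Sg x u) <=
  supply_rate w (u - k_u Sg xb) (output Sg x u - k_y Sg xb).
Proof.
move=> xbE x u; have [_ _ _ [k [W [l [_ fE GE WE]]]]] := HM.
have {}fE := fE x xb xbE; have {}GE := GE x xb xbE.
have fG : sys_f Sg xb + sys_G Sg *m k_u Sg xb = 0.
  by have [ub e] := xbE; rewrite -(k_u_unique rG e).
have [Qs Rs] := ws.
set g := grad V x - grad V xb in fE GE *.
set df := sys_f Sg x - sys_f Sg xb in fE.
set dh := sys_h Sg x - sys_h Sg xb in fE GE.
set du := u - k_u Sg xb.
(* The rate vanishes at the equilibrium pair, so it may be replaced by its increment, the form in
   which the identities are stated. *)
have rateE : rate Sg x u = df + sys_G Sg *m du.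
  rewrite -[LHS]subr0 -fG /rate /df /du mulmxBr.
  by rewrite opprD addrACA.
have outE : output Sg x u - k_y Sg xb = dh + sys_J Sg *m du.
  by rewrite /output /k_y /dh /du mulmxBr opprD addrACA.
clearbody du df dh g.
have GE2 : dotv g (sys_G Sg *m du) = 2 * (dotv dh (sup_Q w *m (sys_J Sg *m du))
    + dotv dh (sup_S w *m du) - dotv (l x xb) (W *m du)).
  have -> : dotv g (sys_G Sg *m du) = 2 * ((2^-1 *: (g^T *m sys_G Sg)) *m du) 0 0.
    by rewrite /dotv -scalemxAl [in RHS]mxE mulrA divff // mul1r mulmxA.
  rewrite GE mulmxBl mxE [X in _ + X]mxE /dotv.
  by rewrite mulmxDr mulmxDl mxE !mulmxA.
have WE2 : dotv (W *m du) (W *m du) = dotv du (sup_R w *m du) +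
    2 * dotv (sys_J Sg *m du) (sup_S w *m du) +
    dotv (sys_J Sg *m du) (sup_Q w *m (sys_J Sg *m du)).
  rewrite dotvT mulmxA WE !mulmxDl !dotvDr.
  rewrite -!mulmxA (dotvT (sys_J Sg)^T) trmxK.
  rewrite [dotv du ((sup_S w)^T *m _)]dotvT trmxK.
  rewrite [dotv du ((sys_J Sg)^T *m _)]dotvT trmxK.
  rewrite (dotvC (sup_S w *m du)) (dotvC (sup_Q w *m _)).
  by ring.
rewrite rateE outE /supply_rate dotvDr fE GE2 !mulmxDr !dotvDr !dotvDl.
rewrite [dotv (sys_J Sg *m du) (sup_Q w *m dh)]dotvT Qs.
have := dotv_ge0 (l x xb + W *m du).
rewrite dotvDr !dotvDl WE2 (dotvC (W *m du)).
lra.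
Qed.

End HillMoylan.

(** * Bregman divergences of convex functions *)

Section Bregman.
Context {R : realType} {n : nat}.
Variables (V : 'cV[R]_n -> R) (xb : 'cV[R]_n).
Hypothesis dV : forall x, differentiable V x.

Lemma differentiable_dotv (c x : 'cV[R]_n) : differentiable (dotv c) x.
Proof.
have -> : dotv c = \sum_i (fun y : 'cV[R]_n => c i 0 *: (y i 0)).
  apply/funext => y; rewrite fct_sumE /dotv mxE.
  by apply: eq_bigr => i _; rewrite mxE.
apply: differentiable_sum => i.
by apply: differentiableZ; exact: differentiable_coord.
Qed.

Lemma derive_dotv (c x v : 'cV[R]_n) : 'D_v (dotv c) x = dotv c v.
Proof.
have H : h^-1 *: ((dotv c \o shift x) (h *: v) - dotv c x) @[h --> 0^'] -->
    dotv c v.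
  apply: (@cvg_near_cst _ _ _ _ _ _).
  near=> h; rewrite /= dotvDr addrK dotvZr /GRing.scale /= mulKf //.
  by near: h; exact: nbhs_dnbhs_neq.
exact: (cvg_lim _ H).
Unshelve. all: by end_near. Qed.

Lemma differentiable_bregman x : differentiable (bregman V xb) x.
Proof.
have -> : bregman V xb =
    (V - cst (V xb)) - (dotv (grad V xb) - cst (dotv (grad V xb) xb)).
  by apply/funext => y; rewrite /bregman dotvBr.
apply: differentiableB; apply: differentiableB => //.
exact: differentiable_dotv.
Qed.

Lemma grad_bregman x : grad (bregman V xb) x = grad V x - grad V xb.
Proof.
apply/colP => i; rewrite !mxE.
have -> : bregman V xb =
    (V - cst (V xb)) - (dotv (grad V xb) - cst (dotv (grad V xb) xb)).
  by apply/funext => y; rewrite /bregman dotvBr.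
have dd c : derivable (dotv c) x (delta_mx i 0).
  exact/diff_derivable/differentiable_dotv.
rewrite deriveB; last 2 first.
- by apply: derivableB => //; exact/diff_derivable.
- exact: derivableB.
rewrite deriveB //; last exact/diff_derivable.
rewrite deriveB // !derive_cst !subr0 derive_dotv !derive_grad //.
Qed.

Lemma is_derive_line (x d : 'cV[R]_n) (t : R) :
  is_derive t 1 (fun t => x + t *: d) d.
Proof.
apply/is_derive_cV => i.
have -> : (fun t : R => (x + t *: d) i 0) = (fun t => x i 0 + t * d i 0).
  by apply/funext => s; rewrite !mxE.
have ? : is_derive t 1 (fun t : R => t * d i 0) (d i 0).
  have -> : (fun t : R => t * d i 0) = d i 0 \*: (id : R -> R).
    by apply/funext => s; rewrite /= mulrC.
  by apply: is_derive_eq (is_deriveZ _ (is_derive_id t 1)) _; exact: mulr1.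
by rewrite -[X in is_derive _ _ _ X]add0r; exact: is_deriveD.
Qed.

(** The mean value theorem on the segment from [xb] to [x]. The factor [s] turns the direction
    [x - xb] into the displacement of the intermediate point, so that monotonicity of the gradient
    applies to that point and [xb]. *)
Lemma bregman_mvt (x : 'cV[R]_n) : exists2 s : R, 0 < s &
  s * bregman V xb x =
  dotv (grad V (xb + s *: (x - xb)) - grad V xb) (xb + s *: (x - xb) - xb).
Proof.
pose c s := xb + s *: (x - xb).
have dB (s : R) : is_derive s 1 (bregman V xb \o c)
    (dotv (grad V (c s) - grad V xb) (x - xb)).
  rewrite -grad_bregman; apply: is_derive_grad; last exact: is_derive_line.
  exact: differentiable_bregman.
have cBc : {within `[0, 1], continuous (bregman V xb \o c)}.
  apply: continuous_subspaceT => s.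
  by apply/differentiable_continuous/derivable1_diffP; case: (dB s).
have [s s01 E] := MVT ltr01 (fun s _ => dB s) cBc.
exists s; first by case/andP: s01.
have -> : bregman V xb x = dotv (grad V (c s) - grad V xb) (x - xb).
  move: E; rewrite /= /c scale1r scale0r addr0 subrKC subr0 mulr1 => <-.
  by rewrite /bregman !subrr dotv0r !subr0.
by rewrite addrAC subrr add0r dotvZr.
Qed.

Lemma bregman_gt0 x : strictly_convex V -> x != xb -> 0 < bregman V xb x.
Proof.
move=> sV xxb; have [s s0 E] := bregman_mvt x.
rewrite -(pmulr_rgt0 _ s0) E; apply: sV.
by rewrite -subr_eq0 addrAC subrr add0r scaler_eq0 gt_eqF // subr_eq0.
Qed.

Hypothesis cV : convex_function [set: 'cV[R]_n] V.

Lemma convex_line x (t : R) : 0 <= t <= 1 ->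
  V (xb + t *: (x - xb)) <= V xb + t * (V x - V xb).
Proof.
move=> t01. have /andP[t0 t1] := t01.
have := cV (Itv01 t0 t1) (mem_set I : x \in [set: _]) (mem_set I : xb \in [set: _]).
rewrite convRE /conv /= /unstable.onem.
have -> : t *: x + (1 - t) *: xb = xb + t *: (x - xb).
  by rewrite scalerBl scale1r scalerBr addrCA.
by move/le_trans; apply; lra.
Qed.

(** The subtracted linear term scales exactly with [t], so this is convexity of [V] on the segment;
    it is the source of coercivity. *)
Lemma bregman_scale x (t : R) : 0 <= t <= 1 ->
  bregman V xb (xb + t *: (x - xb)) <= t * bregman V xb x.
Proof.
move=> t01; have e : xb + t *: (x - xb) - xb = t *: (x - xb) by rewrite addrC addKr.
rewrite /bregman e dotvZr.
have := convex_line x t01; lra.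
Qed.

(** By convexity the difference quotients of [V] at [xb] towards [x] are at most [V x - V xb], and
    they tend to the directional derivative. *)
Lemma bregman_ge0 x : 0 <= bregman V xb x.
Proof.
rewrite /bregman subr_ge0; apply/ler_addgt0Pr => e e0.
have /cvg_ex[/= l Vl] : derivable V xb (x - xb) by exact/diff_derivable.
have lE : l = dotv (grad V xb) (x - xb).
  by rewrite -derive_grad //; apply/esym/cvg_lim.
move/cvgrPdist_le : Vl => /(_ _ e0)[r /= r0 Vr].
(* Below [r] for closeness to the limit, at most 1 for convexity. *)
pose h := Num.min (r / 2) 1.
have h0 : 0 < h by rewrite lt_min divr_gt0 /=.
have hr : h < r by rewrite gt_min; apply/orP; left; lra.
have h1 : 0 <= h <= 1 by rewrite ltW //= ge_min lexx orbT.
have := Vr h; rewrite /= sub0r normrN gtr0_norm // gt_eqF // => /(_ hr isT).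
rewrite lE ler_norml => /andP[_].
have := convex_line x h1; rewrite addrC -lerBlDl -ler_pdivrMl //.
rewrite /GRing.scale /=; lra.
Qed.

End Bregman.

(** * Linear growth away from the minimum *)

Section Coercivity.
Context {R : realType} {n : nat}.
Variables (B : 'cV[R]_n -> R) (xb : 'cV[R]_n).
Hypotheses (cB : continuous B) (B_gt0 : forall x, x != xb -> 0 < B x)
  (B_scale : forall x t, 0 <= t <= 1 -> B (xb + t *: (x - xb)) <= t * B x).

(** A point outside the ball is pulled back radially to the sphere of radius [r], where [B] is at
    least its minimum [beta]. With [t = r / |x - xb|], [B_scale] reads [beta <= t * B x]. *)
Lemma starlike_growth (r : R) : 0 < r -> exists2 beta, 0 < beta &
  forall x, r <= `|x - xb| -> beta * `|x - xb| <= r * B x.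
Proof.
move=> r0; pose K := [set x : 'cV[R]_n | `|x - xb| = r].
have proj x : r <= `|x - xb| -> exists2 t : R, K (xb + t *: (x - xb)) &
    0 <= t <= 1 /\ t * `|x - xb| = r.
  move=> xr; have x0 : 0 < `|x - xb| by apply: lt_le_trans xr.
  have tr : r / `|x - xb| * `|x - xb| = r by rewrite divfK // gt_eqF.
  exists (r / `|x - xb|); last first.
    split=> //; apply/andP; split; first by rewrite divr_ge0 // ltW.
    by rewrite ler_pdivrMr // mul1r.
  by rewrite /K /= addrAC subrr add0r normrZ ger0_norm // divr_ge0 // ltW.
(* The sphere is empty in dimension 0, where no point lies outside the ball and any constant
   does. *)
have [K0|K0] := pselect (K !=set0); last first.
  exists 1 => // x /proj[t Kt _]; exfalso; apply: K0; by exists (xb + t *: (x - xb)).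
have cK : compact K.
  apply: (@subclosed_compact _ K [set x : 'cV[R]_n | `|x - xb| <= r]).
  - suff : closed ((fun x : 'cV[R]_n => `|x - xb|) @^-1` [set r]) by [].
    apply: preimage_closed; last exact: closed_eq.
    move=> x _; apply: (@cvg_norm _ _ _ (nbhs x)).
    by apply: cvgB; [exact: cvg_id|exact: cvg_cst].
  - exact: compact_norm_le.
  - by move=> x /= ->.
have [y /set_mem yK yB] := compact_EVT_min K0 cK (continuous_subspaceT cB).
exists (B y).
  by apply: B_gt0; rewrite -subr_eq0 -normr_gt0 yK.
move=> x /proj[t Kt [t01 tr]].
have : B y <= t * B x.
  by apply: le_trans (B_scale _ t01); apply: yB; exact/mem_set.
move=> /(ler_wpM2r (normr_ge0 (x - xb))) /le_trans; apply.
by rewrite -tr mulrAC.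
Qed.

End Coercivity.

(** * The weighted sum of two Bregman divergences *)

Section Storage.
Context {R : realType} {n1 n2 : nat}.
Variables (V1 : 'cV[R]_n1 -> R) (V2 : 'cV[R]_n2 -> R) (kappa : R)
  (xb : 'cV[R]_(n1 + n2)).
Hypotheses (dV1 : forall x, differentiable V1 x)
  (dV2 : forall x, differentiable V2 x).

Let B := storage_cl V1 V2 kappa xb.
Let B1 := bregman V1 (usubmx xb).
Let B2 := bregman V2 (dsubmx xb).

Let storageE : B = (B1 \o usubmx) + kappa \*: (B2 \o dsubmx).
Proof. by []. Qed.

Let differentiable_B1 x : differentiable (B1 \o usubmx) (x : 'cV[R]_(n1 + n2)).
Proof.
apply: differentiable_comp; last exact: differentiable_bregman.
by apply: linear_differentiable; exact: usubmx_continuous.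
Qed.

Let differentiable_B2 x : differentiable (B2 \o dsubmx) (x : 'cV[R]_(n1 + n2)).
Proof.
apply: differentiable_comp; last exact: differentiable_bregman.
by apply: linear_differentiable; exact: dsubmx_continuous.
Qed.

Lemma differentiable_storage x : differentiable B x.
Proof. by rewrite storageE; apply: differentiableD => //; exact: differentiableZ. Qed.

Lemma dotv_grad_storage x v : dotv (grad B x) v =
  dotv (grad V1 (usubmx x) - grad V1 (usubmx xb)) (usubmx v) +
  kappa * dotv (grad V2 (dsubmx x) - grad V2 (dsubmx xb)) (dsubmx v).
Proof.
rewrite -derive_grad; last exact: differentiable_storage.
have d1 : derivable (B1 \o usubmx) x v by exact/diff_derivable.
have d2 : derivable (B2 \o dsubmx) x v by exact/diff_derivable.
rewrite storageE deriveD //; last exact: derivableZ.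
rewrite deriveZ // -!grad_bregman // -!derive_grad; try exact: differentiable_bregman.
have ue h : usubmx (h *: v + x) = h *: usubmx v + usubmx x.
  by apply/matrixP => i j; rewrite !mxE.
have de h : dsubmx (h *: v + x) = h *: dsubmx v + dsubmx x.
  by apply/matrixP => i j; rewrite !mxE.
congr (_ + _ *: _); rewrite /derive.
- by under eq_fun do rewrite /= ue.
- by under eq_fun do rewrite /= de.
Qed.

Lemma grad_storage x : grad B x =
  col_mx (grad V1 (usubmx x) - grad V1 (usubmx xb))
         (kappa *: (grad V2 (dsubmx x) - grad V2 (dsubmx xb))).
Proof.
have inj (a b : 'cV[R]_(n1 + n2)) : (forall v, dotv a v = dotv b v) -> a = b.
  move=> ab; apply/colP => i; have := ab (delta_mx i 0); rewrite /dotv !mxE.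
  rewrite (bigD1 i) //= big1 ?addr0 => [|j /negPf ji]; last by rewrite !mxE ji mulr0.
  rewrite (bigD1 i) //= big1 ?addr0 => [|j /negPf ji]; last by rewrite !mxE ji mulr0.
  by rewrite !mxE !eqxx !mulr1.
apply: inj => v; rewrite dotv_grad_storage -[in RHS](vsubmxK v) dotv_col.
by rewrite dotvZl.
Qed.

Lemma storage_xb : B xb = 0.
Proof.
by rewrite /B /storage_cl /bregman !subrr !dotv0r !subr0 mulr0 addr0.
Qed.

Lemma cont_differentiable_storage :
  continuous (grad V1) -> continuous (grad V2) -> cont_differentiable B.
Proof.
move=> c1 c2; split=> [x|]; first exact: differentiable_storage.
rewrite (_ : grad _ = fun x => col_mx (grad V1 (usubmx x) - grad V1 (usubmx xb))
    (kappa *: (grad V2 (dsubmx x) - grad V2 (dsubmx xb)))); last first.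
  by apply/funext => x; exact: grad_storage.
move=> x; apply: (@cvg_cV _ _ _ _ (nbhs_filter x)) => i.
have cg1 : continuous (fun x : 'cV[R]_(n1 + n2) =>
    grad V1 (usubmx x) - grad V1 (usubmx xb)).
  move=> y; apply: (@cvgB _ _ _ _ (nbhs_filter y)); last exact: cvg_cst.
  exact: (@cvg_comp _ _ _ usubmx (grad V1) _ _ _ (@usubmx_continuous _ _ _ y) (c1 _)).
have cg2 : continuous (fun x : 'cV[R]_(n1 + n2) =>
    kappa *: (grad V2 (dsubmx x) - grad V2 (dsubmx xb))).
  move=> y; apply: (@cvgZl_tmp _ _ _ _ (nbhs_filter y)).
  apply: (@cvgB _ _ _ _ (nbhs_filter y)); last exact: cvg_cst.
  exact: (@cvg_comp _ _ _ dsubmx (grad V2) _ _ _ (@dsubmx_continuous _ _ _ y) (c2 _)).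
rewrite -(splitK i); case: (fintype.split i) => j /=.
  rewrite col_mxEu; under eq_fun do rewrite col_mxEu.
  exact: (@cvg_comp _ _ _ _ (fun v => v j 0) _ _ _ (cg1 x) (@coord_continuous _ _ _ _)).
rewrite col_mxEd; under eq_fun do rewrite col_mxEd.
exact: (@cvg_comp _ _ _ _ (fun v => v j 0) _ _ _ (cg2 x) (@coord_continuous _ _ _ _)).
Qed.

Hypotheses (k0 : 0 < kappa) (cV1 : convex_function [set: 'cV[R]_n1] V1)
  (cV2 : convex_function [set: 'cV[R]_n2] V2).

Lemma storage_ge0 x : 0 <= B x.
Proof.
apply: addr_ge0; first exact: bregman_ge0.
by apply: mulr_ge0; [exact: ltW|exact: bregman_ge0].
Qed.

Lemma storage_gt0 x : strictly_convex V1 -> strictly_convex V2 ->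
  x != xb -> 0 < B x.
Proof.
move=> s1 s2 xxb; have [e1|n1x] := eqVneq (usubmx x) (usubmx xb).
  have [e2|n2x] := eqVneq (dsubmx x) (dsubmx xb).
    by move: xxb; rewrite -(vsubmxK x) -(vsubmxK xb) e1 e2 eqxx.
  apply: ltr_wpDl; first exact: bregman_ge0.
  by apply: mulr_gt0 => //; exact: bregman_gt0.
apply: ltr_pwDl; first exact: bregman_gt0.
by apply: mulr_ge0; [exact: ltW|exact: bregman_ge0].
Qed.

Lemma storage_scale x (t : R) : 0 <= t <= 1 ->
  B (xb + t *: (x - xb)) <= t * B x.
Proof.
move=> t01; rewrite /B /storage_cl.
have -> : usubmx (xb + t *: (x - xb)) =
    usubmx xb + t *: (usubmx x - usubmx xb) by apply/matrixP => i j; rewrite !mxE.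
have -> : dsubmx (xb + t *: (x - xb)) =
    dsubmx xb + t *: (dsubmx x - dsubmx xb) by apply/matrixP => i j; rewrite !mxE.
rewrite [t * _]mulrDr [t * (kappa * _)]mulrCA; apply: lerD; first exact: bregman_scale.
by rewrite ler_pM2l //; exact: bregman_scale.
Qed.

End Storage.

(** * Dissipativity of the closed loop *)

Section ClosedLoop.
Context {R : realType} {n1 n2 m p : nat}.
Variables (S1 : system R n1 m p) (S2 : system R n2 p m)
  (w1 : supply R m p) (w2 : supply R p m)
  (V1 : 'cV[R]_n1 -> R) (V2 : 'cV[R]_n2 -> R).
Hypotheses (sa1 : standing_assumptions S1) (sa2 : standing_assumptions S2)
  (wp : 1%:M + sys_J S1 *m sys_J S2 \in unitmx)
  (ws1 : supply_symmetric w1) (ws2 : supply_symmetric w2)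
  (HM1 : EID_Hill_Moylan S1 V1 w1) (HM2 : EID_Hill_Moylan S2 V2 w2).

Notation C := (closed_loop S1 S2).

Let r1 : \rank (sys_G S1) = m. Proof. by case: sa1. Qed.
Let r2 : \rank (sys_G S2) = p. Proof. by case: sa2. Qed.
Let dV1 x : differentiable V1 x. Proof. by case: HM1 => _ []. Qed.
Let dV2 x : differentiable V2 x. Proof. by case: HM2 => _ []. Qed.
Let cV1 : convex_function [set: 'cV[R]_n1] V1. Proof. by case: HM1. Qed.
Let cV2 : convex_function [set: 'cV[R]_n2] V2. Proof. by case: HM2. Qed.

Lemma closed_loop_equilibria xb : equilibria C xb ->
  equilibria S1 (usubmx xb) /\ equilibria S2 (dsubmx xb).
Proof. by rewrite -{1}(vsubmxK xb) => /(closed_loop_equilibriaP wp). Qed.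

Lemma closed_loop_k_uE xb : equilibria C xb -> k_u C xb =
  col_mx (k_u S1 (usubmx xb) + k_y S2 (dsubmx xb))
         (k_u S2 (dsubmx xb) - k_y S1 (usubmx xb)).
Proof.
move=> /closed_loop_equilibria[e1 e2].
by rewrite -{1}(vsubmxK xb) closed_loop_k_u.
Qed.

Lemma closed_loop_k_yE xb : equilibria C xb -> k_y C xb =
  col_mx (k_y S1 (usubmx xb)) (k_y S2 (dsubmx xb)).
Proof.
move=> xbE; rewrite -[k_y C xb]/(output C xb (k_u C xb)) closed_loop_k_uE //.
by rewrite -{1}(vsubmxK xb); apply/closed_loop_outputP => //; rewrite addrK subrK.
Qed.

Lemma closed_loop_dissipation (kappa : R) xb : 0 < kappa -> equilibria C xb ->
  forall x v, dotv (grad (storage_cl V1 V2 kappa xb) x) (rate C x v) <=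
    supply_rate (supply_cl w1 w2 kappa) (v - k_u C xb) (output C x v - k_y C xb).
Proof.
move=> k0 xbE x v; have [e1 e2] := closed_loop_equilibria xbE.
rewrite closed_loop_k_uE // closed_loop_k_yE // dotv_grad_storage //.
have yE : output C (col_mx (usubmx x) (dsubmx x)) (col_mx (usubmx v) (dsubmx v)) =
    col_mx (usubmx (output C x v)) (dsubmx (output C x v)) by rewrite !vsubmxK.
have [y1E y2E] := (closed_loop_outputP wp _ _ _ _ _ _).1 yE.
have := closed_loop_rateE yE; rewrite !vsubmxK => ->.
rewrite col_mxKu col_mxKd -[X in supply_rate _ (X - _) _]vsubmxK.
rewrite -[X in supply_rate _ _ (X - _)]vsubmxK.
move: y1E y2E; set y1 := usubmx (output _ _ _); set y2 := dsubmx (output _ _ _).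
move=> y1E y2E.
rewrite !opp_col_mx !add_col_mx supply_rate_cl //.
have H1 := Hill_Moylan_dissipation r1 ws1 HM1 e1 (usubmx x) (usubmx v - y2).
have H2 := Hill_Moylan_dissipation r2 ws2 HM2 e2 (dsubmx x) (dsubmx v + y1).
move: H1 H2; rewrite -y1E -y2E => H1 H2.
(* The interconnection is linear, so deviations from equilibrium obey the same feedback equations as
   the signals themselves. *)
have -> : usubmx v - (k_u S1 (usubmx xb) + k_y S2 (dsubmx xb)) -
    (y2 - k_y S2 (dsubmx xb)) = usubmx v - y2 - k_u S1 (usubmx xb).
  by apply/matrixP => i j; rewrite !mxE; ring.
have -> : dsubmx v - (k_u S2 (dsubmx xb) - k_y S1 (usubmx xb)) +
    (y1 - k_y S1 (usubmx xb)) = dsubmx v + y1 - k_u S2 (dsubmx xb).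
  by apply/matrixP => i j; rewrite !mxE; ring.
by rewrite lerD // ler_pM2l.
Qed.

Lemma closed_loop_EID (kappa : R) : 0 < kappa ->
  EID C (supply_cl w1 w2 kappa) (storage_cl V1 V2 kappa).
Proof.
move=> k0 xb xbE; split.
- by move=> x; exact: storage_ge0.
- apply: cont_differentiable_storage => //.
    by case: HM1 => _ [].
  by case: HM2 => _ [].
- exact: storage_xb.
- by move=> T u x _ _ t _ _; exact: closed_loop_dissipation.
Qed.

Lemma closed_loop_locally_lipschitz v : locally_lipschitz (fun x => rate C x v).
Proof.
have [_ _ f1L h1L _] := sa1; have [_ _ f2L h2L _] := sa2.
have h1 : locally_lipschitz (fun x : 'cV[R]_(n1 + n2) =>
    cl_h1 S1 S2 (usubmx x) (dsubmx x)).
  apply: locally_lipschitz_mulmx; apply: locally_lipschitzB.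
    exact: locally_lipschitz_usubmx.
  by apply: locally_lipschitz_mulmx; exact: locally_lipschitz_dsubmx.
have h2 : locally_lipschitz (fun x : 'cV[R]_(n1 + n2) =>
    cl_h2 S1 S2 (usubmx x) (dsubmx x)).
  apply: locally_lipschitzD; first exact: locally_lipschitz_dsubmx.
  exact: locally_lipschitz_mulmx.
apply: locally_lipschitzD; last exact: locally_lipschitz_cst.
apply: locally_lipschitz_col_mx.
  apply: locally_lipschitzB; first exact: locally_lipschitz_usubmx.
  exact: locally_lipschitz_mulmx.
apply: locally_lipschitzD; first exact: locally_lipschitz_dsubmx.
exact: locally_lipschitz_mulmx.
Qed.

End ClosedLoop.

(** * Uniqueness and stability of the closed-loop equilibrium *)

Section ClosedLoopStability.
Context {R : realType} {n1 n2 m p : nat}.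
Variables (S1 : system R n1 m p) (S2 : system R n2 p m)
  (w1 : supply R m p) (w2 : supply R p m)
  (V1 : 'cV[R]_n1 -> R) (V2 : 'cV[R]_n2 -> R).
Hypotheses (sa1 : standing_assumptions S1) (sa2 : standing_assumptions S2)
  (wp : 1%:M + sys_J S1 *m sys_J S2 \in unitmx)
  (ws1 : supply_symmetric w1) (ws2 : supply_symmetric w2)
  (HM1 : EID_Hill_Moylan S1 V1 w1) (HM2 : EID_Hill_Moylan S2 V2 w2)
  (obs1 : eq_indep_observable S1) (obs2 : eq_indep_observable S2).

Notation C := (closed_loop S1 S2).

Lemma rate_continuous n k l (Sg : system R n k l) v :
  standing_assumptions Sg -> continuous (fun x => rate Sg x v).
Proof.
move=> [_ _ fL _ _]; apply: locally_lipschitz_continuous.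
by apply: locally_lipschitzD => //; exact: locally_lipschitz_cst.
Qed.

Lemma rate_k_u n k l (Sg : system R n k l) xb : \rank (sys_G Sg) = k ->
  equilibria Sg xb -> rate Sg xb (k_u Sg xb) = 0.
Proof. by move=> rG [u e]; rewrite -(k_u_unique rG e). Qed.

(** Resting at [x] is a trajectory for the input of [xb] that shows the output of [xb], which
    observability at [xb] allows only for [xb] itself. *)
Lemma observable_equilibrium n k l (Sg : system R n k l) x xb :
  standing_assumptions Sg -> eq_indep_observable Sg ->
  equilibria Sg x -> equilibria Sg xb ->
  k_u Sg x = k_u Sg xb -> k_y Sg x = k_y Sg xb -> x = xb.
Proof.
move=> sa obs xE xbE ue ye; have [_ rG _ _ _] := sa.
apply: (obs xb xbE (fun=> x) _ _ 0) => // [|t _].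
  apply/(trajectory_solution (rate_continuous (v := _) sa)); split.
    by apply: continuous_subspaceT => t; exact: cvg_cst.
  move=> t _ _; rewrite -ue rate_k_u //; exact: is_derive_cst.
by rewrite -ye -ue.
Qed.

Lemma eq_outputs_k_y n k l (Sg : system R n k l) xb :
  equilibria Sg xb -> eq_outputs Sg (k_u Sg xb) (k_y Sg xb).
Proof. by exists xb. Qed.

Lemma closed_loop_unique_equilibrium xb :
  (forall (v1 : 'cV[R]_m) (v2 : 'cV[R]_p),
     exists! y : 'cV[R]_p * 'cV[R]_m,
       eq_outputs S1 (v1 - y.2) y.1 /\ eq_outputs S2 (v2 + y.1) y.2) ->
  equilibria C xb -> unique_equilibrium C (k_u C xb) xb.
Proof.
move=> uniq xbE x; have [_ r1 _ _ _] := sa1; have [_ r2 _ _ _] := sa2.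
have rC := closed_loop_rank wp r1 r2.
split=> [xE0|->]; last exact: rate_k_u.
have xE : equilibria C x by exists (k_u C xb).
have := k_u_unique rC xE0; rewrite !(closed_loop_k_uE sa1 sa2 wp) //.
have [e1 e2] := closed_loop_equilibria wp xE.
have [b1 b2] := closed_loop_equilibria wp xbE.
move=> /eq_col_mx[v1E v2E].
(* Both equilibria solve the inclusions for the same external input, so their outputs agree; the
   feedback equations then equate the subsystem inputs. *)
have [y [_ yU]] := uniq (k_u S1 (usubmx xb) + k_y S2 (dsubmx xb))
  (k_u S2 (dsubmx xb) - k_y S1 (usubmx xb)).
have [] : (k_y S1 (usubmx xb), k_y S2 (dsubmx xb)) =
    (k_y S1 (usubmx x), k_y S2 (dsubmx x)).
  rewrite -(yU (k_y S1 (usubmx xb), k_y S2 (dsubmx xb))); last first.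
    by rewrite /= addrK subrK; split; exact: eq_outputs_k_y.
  apply: yU; rewrite /= v1E v2E addrK subrK; split; exact: eq_outputs_k_y.
move=> y1E y2E.
move: v1E v2E; rewrite y1E y2E => /addIr u1E /addIr u2E.
rewrite -(vsubmxK x) -(vsubmxK xb); congr col_mx.
  exact: (observable_equilibrium sa1 obs1).
exact: (observable_equilibrium sa2 obs2).
Qed.

Lemma supply_rate0 k l (w : supply R k l) y :
  supply_rate w 0 y = quad_form (sup_Q w) y.
Proof. by rewrite /supply_rate !mulmx0 !dotv0r mulr0 !addr0. Qed.

Variables (kappa : R) (xb : 'cV[R]_(n1 + n2)).
Hypotheses (k0 : 0 < kappa)
  (Qneg : negative_definite (sup_Q (supply_cl w1 w2 kappa)))
  (xbE : equilibria C xb).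

Let F x := rate C x (k_u C xb).
Let B := storage_cl V1 V2 kappa xb.

(** At the equilibrium input the supply rate reduces to the quadratic form of [Q_cl] in the output
    deviation, which is negative unless that deviation vanishes. *)
Lemma closed_loop_decrease x : dotv (grad B x) (F x) <= 0 /\
  (dotv (grad B x) (F x) = 0 -> output C x (k_u C xb) = k_y C xb).
Proof.
have := closed_loop_dissipation sa1 sa2 wp ws1 ws2 HM1 HM2 k0 xbE x (k_u C xb).
rewrite subrr supply_rate0 -/(F x) -/B => le.
have [y0|/Qneg lt0] := eqVneq (output C x (k_u C xb) - k_y C xb) 0.
  split=> [|_]; last exact/subr0_eq.
  by apply: le_trans le _; rewrite y0 /quad_form mulmx0 dotv0r.
split=> [|e]; first exact: le_trans le (ltW lt0).
by move: (le_lt_trans le lt0); rewrite e ltxx.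
Qed.

Lemma closed_loop_observable z : solution F +oo%E z ->
  (forall t, 0 < t -> dotv (grad B (z t)) (F (z t)) = 0) -> z 1 = xb.
Proof.
move=> zF z0; have [b1 b2] := closed_loop_equilibria wp xbE.
have [_ r1 _ _ _] := sa1; have [_ r2 _ _ _] := sa2.
(* After the shift the output is at equilibrium from time 0 on, as observability requires. *)
pose y t := z (1 + t).
have outE t : 0 <= t -> output C (y t) (k_u C xb) = k_y C xb.
  by move=> t0; apply/(closed_loop_decrease _).2/z0; rewrite ltr_wpDr.
have [cy dy] : solution F +oo%E y := solution_shift ler01 zF.
have -> : z 1 = y 0 by rewrite /y addr0.
clearbody y.
have outE' t : 0 <= t ->
    output C (col_mx (usubmx (y t)) (dsubmx (y t)))
      (col_mx (k_u S1 (usubmx xb) + k_y S2 (dsubmx xb))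
         (k_u S2 (dsubmx xb) - k_y S1 (usubmx xb))) =
    col_mx (k_y S1 (usubmx xb)) (k_y S2 (dsubmx xb)).
  move=> t0; rewrite vsubmxK -(closed_loop_k_uE sa1 sa2 wp) //.
  by rewrite -(closed_loop_k_yE sa1 sa2 wp) //; exact: outE.
(* With both outputs at equilibrium, each subsystem receives exactly its own equilibrium input, so
   the loop decouples into two trajectories to which [obs1] and [obs2] apply. *)
have FE t : 0 <= t -> F (y t) =
    col_mx (rate S1 (usubmx (y t)) (k_u S1 (usubmx xb)))
           (rate S2 (dsubmx (y t)) (k_u S2 (dsubmx xb))).
  move=> t0; have := closed_loop_rateE (outE' t t0).
  by rewrite addrK subrK vsubmxK -(closed_loop_k_uE sa1 sa2 wp).
rewrite -(vsubmxK (y 0)) -(vsubmxK xb); congr col_mx.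
  apply: (obs1 b1 (x := fun t => usubmx (y t)) _ _ (lexx 0)).
    apply/(trajectory_solution (rate_continuous (v := _) sa1)); split.
      exact: (within_continuous_comp (@usubmx_continuous _ _ _) cy).
    move=> t t0 tT; apply/is_derive_cV => i.
    under eq_fun do rewrite mxE.
    have /is_derive_cV/(_ (lshift n2 i)) := dy t t0 tT.
    by rewrite FE ?ltW // col_mxEu.
  by move=> t /outE' /(closed_loop_outputP wp)[+ _]; rewrite addrK => ->.
apply: (obs2 b2 (x := fun t => dsubmx (y t)) _ _ (lexx 0)).
  apply/(trajectory_solution (rate_continuous (v := _) sa2)); split.
    exact: (within_continuous_comp (@dsubmx_continuous _ _ _) cy).
  move=> t t0 tT; apply/is_derive_cV => i.
  under eq_fun do rewrite mxE.
  have /is_derive_cV/(_ (rshift n1 i)) := dy t t0 tT.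
  by rewrite FE ?ltW // col_mxEd.
by move=> t /outE' /(closed_loop_outputP wp)[_]; rewrite subrK => ->.
Qed.

(* Strict convexity already makes the convex function [B] coercive, hence the
   stability global. *)
Lemma closed_loop_globally_asymptotically_stable :
  strictly_convex V1 -> strictly_convex V2 ->
  globally_asymptotically_stable C (k_u C xb) xb.
Proof.
move=> sV1 sV2.
have [_ [dV1 _] cV1 _] := HM1; have [_ [dV2 _] cV2 _] := HM2.
have FL : locally_lipschitz F by exact: closed_loop_locally_lipschitz.
have cF : continuous F by exact: locally_lipschitz_continuous.
have dB x : differentiable B x by exact: differentiable_storage.
have cB : continuous B by move=> x; exact: differentiable_continuous.
have decr x := (closed_loop_decrease x).1.
have B0 x : 0 <= B x by exact: storage_ge0.
have Bgt0 x : x != xb -> 0 < B x by exact: storage_gt0.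
have Bxb : B xb = 0 by exact: storage_xb.
have Bs x (t : R) : 0 <= t <= 1 -> B (xb + t *: (x - xb)) <= t * B x.
  exact: storage_scale.
have Bpos (r : R) : 0 < r -> exists2 beta, 0 < beta &
    forall x, B x < beta -> `|x - xb| < r.
  move=> r0; have [beta beta0 Bb] := starlike_growth cB Bgt0 Bs r0.
  exists beta => // x Bx; rewrite ltNge; apply/negP => rx.
  have := Bb x rx; have := ler_wpM2l (ltW beta0) rx.
  move: Bx; rewrite -(ltr_pM2l r0); lra.
have Bcoer (c : R) : exists2 rho, 0 <= rho & forall x, B x <= c -> `|x - xb| <= rho.
  have [beta beta0 Bb] := starlike_growth cB Bgt0 Bs ltr01.
  (* The growth bound at radius 1 handles points outside the unit ball, the summand 1 those inside;
     [|c|] keeps the radius nonnegative for every [c]. *)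
  exists (1 + `|c| / beta) => [|x Bx]; first by rewrite addr_ge0 // divr_ge0 // ltW.
  have c0 : 0 <= `|c| / beta by rewrite divr_ge0 // ltW.
  have [x1|/ltW x1] := leP 1 `|x - xb|; last by rewrite (le_trans x1) // lerDl.
  apply: (@le_trans _ _ (`|c| / beta)); last by rewrite lerDr.
  rewrite ler_pdivlMr // mulrC (le_trans (Bb x x1)) // mul1r.
  exact: le_trans Bx (ler_norm c).
have tsol T x : trajectory C T (fun=> k_u C xb) x <-> solution F T x.
  exact: trajectory_solution.
split=> [e e0|x0].
  have [d d0 dst] := lyapunov_stable dB decr Bxb Bpos e0.
  by exists d => // T x /tsol; exact: dst.
split.
  have [x xF xx0] := solution_exists FL dB decr Bcoer x0.
  by exists x => //; exact/tsol.
move=> x /tsol xF _.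
by apply: (lasalle_cvg FL dB decr B0 Bxb Bpos Bcoer _ xF); exact: closed_loop_observable.
Qed.

End ClosedLoopStability.

Lemma strongly_convex_strictly (R : realType) n (V : 'cV[R]_n -> R) :
  strongly_convex V -> strictly_convex V.
Proof.
move=> [mu mu0 Vmu] x z xz; apply: lt_le_trans (Vmu x z).
rewrite mulr_gt0 // lt_neqAle dotv_ge0 andbT eq_sym.
apply: contraNneq xz; rewrite /dotv mxE.
under eq_bigr do rewrite mxE -expr2.
move/eqP; rewrite psumr_eq0 => [/allP a0|i _]; last exact: sqr_ge0.
rewrite -subr_eq0; apply/eqP/colP => i; rewrite [RHS]mxE.
by have := a0 i (mem_index_enum _); rewrite sqrf_eq0 => /eqP.
Qed.

Theorem theorem4p4 (R : realType) (n1 n2 m p : nat)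
    (S1 : system R n1 m p) (S2 : system R n2 p m)
    (w1 : supply R m p) (w2 : supply R p m)
    (V1 : 'cV[R]_n1 -> R) (V2 : 'cV[R]_n2 -> R) :
  standing_assumptions S1 -> standing_assumptions S2 ->
  1%:M + sys_J S1 *m sys_J S2 \in unitmx ->
  supply_symmetric w1 -> supply_symmetric w2 ->
  sign_indefinite (supply_mx w1) -> sign_indefinite (supply_mx w2) ->
  EID_Hill_Moylan S1 V1 w1 -> EID_Hill_Moylan S2 V2 w2 ->
  (forall (v1 : 'cV[R]_m) (v2 : 'cV[R]_p),
     exists! y : 'cV[R]_p * 'cV[R]_m,
       eq_outputs S1 (v1 - y.2) y.1 /\ eq_outputs S2 (v2 + y.1) y.2) ->
  (forall kappa : R, 0 < kappa ->
     EID (closed_loop S1 S2) (supply_cl w1 w2 kappa)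
         (storage_cl V1 V2 kappa)) /\
  (eq_indep_observable S1 -> eq_indep_observable S2 ->
   (exists2 kappa : R, 0 < kappa &
      negative_definite (sup_Q (supply_cl w1 w2 kappa))) ->
   forall xb, equilibria (closed_loop S1 S2) xb ->
   let vb := k_u (closed_loop S1 S2) xb in
   (strictly_convex V1 -> strictly_convex V2 ->
      unique_equilibrium (closed_loop S1 S2) vb xb /\
      locally_asymptotically_stable (closed_loop S1 S2) vb xb) /\
   (strongly_convex V1 -> strongly_convex V2 ->
      unique_equilibrium (closed_loop S1 S2) vb xb /\
      globally_asymptotically_stable (closed_loop S1 S2) vb xb)).
Proof.
move=> sa1 sa2 wp ws1 ws2 _ _ HM1 HM2 uniq; split.
  by move=> kappa k0; exact: closed_loop_EID.
move=> obs1 obs2 [kappa k0 Qneg] xb xbE vb.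
have ue := closed_loop_unique_equilibrium sa1 sa2 wp obs1 obs2 uniq xbE.
have gas := closed_loop_globally_asymptotically_stable sa1 sa2 wp ws1 ws2
  HM1 HM2 obs1 obs2 k0 Qneg xbE.
split=> sV1 sV2; split=> //.
  (* Every initial state is attracted, so the radius 1 is an arbitrary choice. *)
  by have [st att] := gas sV1 sV2; split=> //; exists 1.
by apply: gas; exact: strongly_convex_strictly.
Qed.
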